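(* Let $d\ge 1$ be an integer, and let $\alpha\in(0,1)$ if $d=1$, respectively $\alpha>0$ if $d>1$. Let $J:\mathbb{Z}^d\times\mathbb{Z}^d\to[0,\infty)$ be a symmetric, translation invariant and integrable kernel such that, for some constant $C_1<\infty$, $J(x,y)\le C_1\|x-y\|^{-d-\alpha}$ for all $x\neq y$ in $\mathbb{Z}^d$. Assume that $\beta_c<\infty$, and that the exponent $\delta$ exists, i.e. there is a real number $\delta>0$ such that $$\mathbb{P}_{\beta_c}(|K_0|\ge n)=n^{-1/\delta+o(1)}\qquad\text{as } n\to\infty .$$ Then $$\delta\ \ge\ \frac{d+(\alpha\wedge 1)}{d-(\alpha\wedge 1)} .$$
   Context: Long-range percolation on $\mathbb{Z}^d$: for a kernel $J:\mathbb{Z}^d\times\mathbb{Z}^d\to[0,\infty)$ that is symmetric ($J(x,y)=J(y,x)$), translation invariant ($J(x,y)=J(0,y-x)$) and integrable ($\sum_{x\in\mathbb{Z}^d}J(0,x)<\infty$), and a parameter $\beta\ge 0$, each unordered pair $\{x,y\}$ of distinct vertices of $\mathbb{Z}^d$ is declared an open edge with probability $1-e^{-\beta J(x,y)}$, independently of all other pairs. $\mathbb{P}_\beta$ denotes the resulting probability measure. $K_0$ is the connected component (cluster) of the origin $0$ in the graph of open edges, and $|K_0|$ its number of vertices. The critical parameter is $\beta_c=\inf\{\beta\ge 0:\mathbb{P}_\beta(|K_0|=\infty)>0\}$. $\|\cdot\|$ is a fixed norm on $\mathbb{R}^d$, and $a\wedge b=\min\{a,b\}$. *)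

(* Defs.v *)
From HB Require Import structures.
From mathcomp Require Import all_boot all_order all_algebra finmap.
From mathcomp Require Import all_classical all_reals all_analysis.

Set Implicit Arguments.
Unset Strict Implicit.
Unset Printing Implicit Defensive.

Import Order.TTheory GRing.Theory Num.Theory.
Import numFieldNormedType.Exports.

Local Open Scope classical_set_scope.
Local Open Scope ring_scope.

Definition is_norm (R : realType) (d : nat) (N : 'rV[R]_d -> R) : Prop :=
  [/\ forall v, 0 <= N v,
      forall v, N v = 0 -> v = 0,
      forall (a : R) v, N (a *: v) = `|a| * N v
    & forall u v, N (u + v) <= N u + N v].

(* The real vector underlying a point of Z^d. *)
Definition toR (R : realType) (d : nat) (x : 'rV[int]_d) : 'rV[R]_d :=
  map_mx (intr : int -> R) x.

Definition symmetric_kernel (R : realType) (d : nat)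
    (J : 'rV[int]_d -> 'rV[int]_d -> R) : Prop :=
  forall x y, J x y = J y x.

Definition translation_invariant (R : realType) (d : nat)
    (J : 'rV[int]_d -> 'rV[int]_d -> R) : Prop :=
  forall x y, J x y = J 0 (y - x).

Definition integrable_kernel (R : realType) (d : nat)
    (J : 'rV[int]_d -> 'rV[int]_d -> R) : Prop :=
  (\esum_(x in [set: 'rV[int]_d]) (J 0 x)%:E < +oo)%E.

(* Unordered pairs of distinct vertices are the two-element finite sets. *)
Definition edge (d : nat) := {e : {fset 'rV[int]_d} | #|` e| == 2%N}.

(* Configurations (true = open) with the product sigma-algebra, i.e. the one
   generated by the coordinate maps. *)
Definition open_edge_events (d : nat) : set (set (edge d -> bool)) :=
  [set [set w : edge d -> bool | w e] | e in [set: edge d]].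

Definition configuration (d : nat) :=
  g_sigma_algebraType (@open_edge_events d).

(* For events, the product rule over all finite subfamilies is mutual
   independence. *)
Definition mutually_independent (R : realType) (disp : measure_display)
    (T : measurableType disp) (P : probability T R) (I : choiceType)
    (E : I -> set T) : Prop :=
  forall A : {fset I},
    P (\bigcap_(i in [set` A]) E i) = (\prod_(i <- A) P (E i))%E.

(* These conditions determine P: it is the product over the edges {x, y} of
   the Bernoulli laws with parameters 1 - exp (- beta J(x, y)). *)
Definition is_percolation_measure (R : realType) (d : nat)
    (J : 'rV[int]_d -> 'rV[int]_d -> R) (beta : R)
    (P : probability (configuration d) R) : Prop :=
  (forall (e : edge d) (x y : 'rV[int]_d), val e = [fset x; y]%fset ->
     P [set w : configuration d | w e] = (1 - expR (- (beta * J x y)))%:E) /\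
  mutually_independent P (fun e : edge d => [set w : configuration d | w e]).

(* The subtype projection insub fails exactly when x = y. *)
Definition open_adj (d : nat) (w : configuration d) (x y : 'rV[int]_d) : bool :=
  if insub [fset x; y]%fset is Some e then w e else false.

Definition cluster0 (d : nat) (w : configuration d) : set 'rV[int]_d :=
  [set x | exists p : seq 'rV[int]_d,
     path (open_adj w) 0 p /\ last 0 p = x].

Definition beta_c (R : realType) (d : nat)
    (P : R -> probability (configuration d) R) : \bar R :=
  ereal_inf [set beta%:E | beta in
    [set beta : R | 0 <= beta /\
      (0 < P beta [set w | infinite_set (cluster0 w)])%E]].

(* |K_0| >= n, as an injection of {0, ..., n - 1} into K_0. *)
Definition cluster_ge (d n : nat) : set (configuration d) :=
  [set w | (`I_n #<= cluster0 w)%card].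
Arguments cluster_ge : clear implicits.

(* P(|K_0| >= n) = n ^ (- 1 / delta + o(1)), the o(1) being eps n. *)
Definition has_exponent_delta (R : realType) (d : nat)
    (P : probability (configuration d) R) (delta : R) : Prop :=
  exists eps : R^nat, eps @ \oo --> (0 : R) /\
    \forall n \near \oo,
      P (cluster_ge d n) = (n%:R `^ (- delta^-1 + eps n))%:E.

(* Main.v *)
Require Import Defs.
From HB Require Import structures.
From mathcomp Require Import all_boot all_order all_algebra finmap.
From mathcomp Require Import all_classical all_reals all_analysis.
From mathcomp Require Import ring lra zify.

Set Implicit Arguments.
Unset Strict Implicit.
Unset Printing Implicit Defensive.

Import Order.TTheory GRing.Theory Num.Theory.
Import numFieldNormedType.Exports.

Local Open Scope classical_set_scope.
Local Open Scope ring_scope.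

(** Write [a] for [min(alpha, 1)] and [L] for the cube of side [n]. If the
    Duminil-Copin--Tassion quantity
    [phi_beta(S) = beta * sum_(x in S, y notin S) P_beta(v <-> x in S) J(x, y)]
    is below 1 for some finite [S] containing [v], the expected cluster size is
    finite; as [phi] is continuous in [beta], [phi_(beta_c)(S) >= 1] for every
    such [S]. Summing over [v] in [S = L] gives
    [n^d <= beta_c * (sum_(x in L, y notin L) J(x, y)) * max_x E|K_x(L)|], where
    [K_x(L)] is the cluster of [x] inside [L], and the boundary sum is at most
    [n^(d - a + o(1))].

    A cluster with [3 M] vertices contains two edge-disjoint connected pieces
    with [M] vertices each, so by the van den Berg--Kesten inequality
    [P(Kmax >= 3^j M) <= P(Kmax >= M)^(2^j)], [Kmax] being the largest cluster
    size in [L]. A first moment bound makes [P(Kmax >= M) <= 1/2] once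
    [M^(1 + 1/delta)] exceeds [n^(d + o(1))], whence [|K_x(L)|] can be truncated
    at [M n^(o(1))] and
    [E|K_x(L)| <= M^(1 - 1/delta + o(1)) = n^(d (delta - 1) / (delta + 1) + o(1))].
    Comparing exponents, [a <= d (delta - 1) / (delta + 1)]. *)

(** * Product measures and the van den Berg-Kesten inequality *)

Section product_expectation.
Context {R : realType} {K : eqType} (p : K -> R).

Definition upd (w : K -> bool) (e : K) (b : bool) : K -> bool :=
  fun e' => if e' == e then b else w e'.

Definition ind (Q : Prop) : R := (`[< Q >])%:R.

Lemma ind_ge0 Q : 0 <= ind Q. Proof. exact: ler0n. Qed.
Lemma ind_le1 Q : ind Q <= 1. Proof. by rewrite /ind; case: asboolP. Qed.

Lemma ind_true (Q : Prop) : Q -> ind Q = 1.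
Proof. by rewrite /ind; case: asboolP. Qed.

Lemma ind_false (Q : Prop) : ~ Q -> ind Q = 0.
Proof. by rewrite /ind; case: asboolP. Qed.

Lemma ind_le (Q Q' : Prop) : (Q -> Q') -> ind Q <= ind Q'.
Proof. by move=> QQ'; rewrite ler_nat; case: asboolP => //= /QQ' ?; case: asboolP. Qed.

Lemma ind_or_and (Q Q' : Prop) : ind (Q \/ Q') + ind (Q /\ Q') = ind Q + ind Q'.
Proof.
rewrite /ind asbool_or asbool_and.
by do 2!case: asboolP => _ /=; rewrite ?addr0 ?add0r.
Qed.

(** Expectation over independent Bernoulli values, with parameters [p], of the coordinates in [s];
    the other coordinates stay frozen as in [w]. *)
Fixpoint Ex (s : seq K) (F : (K -> bool) -> R) (w : K -> bool) : R :=
  if s is e :: s' then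
    p e * Ex s' (fun w => F (upd w e true)) w
      + (1 - p e) * Ex s' (fun w => F (upd w e false)) w
  else F w.

Lemma ExD s F G w : Ex s (fun w => F w + G w) w = Ex s F w + Ex s G w.
Proof. by elim: s F G => //= e s ih F G; rewrite !ih; ring. Qed.

Lemma ExZ s c F w : Ex s (fun w => c * F w) w = c * Ex s F w.
Proof. by elim: s F => //= e s ih F; rewrite !ih; ring. Qed.

Lemma Ex_cst s c w : Ex s (fun=> c) w = c.
Proof. by elim: s => //= e s ->; ring. Qed.

Lemma Ex_sum (I : Type) (r : seq I) (Q : pred I) s (F : I -> (K -> bool) -> R) w :
  Ex s (fun w => \sum_(i <- r | Q i) F i w) w = \sum_(i <- r | Q i) Ex s (F i) w.
Proof.
elim: r => [|i r ih].
  by rewrite big_nil -[RHS](Ex_cst s 0 w); congr (Ex s _ w); apply/funext => w'; rewrite big_nil.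
rewrite big_cons -ih; case: ifPn => Qi; last first.
  by congr (Ex s _ w); apply/funext => w'; rewrite big_cons (negbTE Qi).
by rewrite -ExD; congr (Ex s _ w); apply/funext => w'; rewrite big_cons Qi.
Qed.

Hypothesis p01 : forall e, 0 <= p e <= 1.

Lemma le_Ex s F G w : (forall w, F w <= G w) -> Ex s F w <= Ex s G w.
Proof.
elim: s F G => //= e s ih F G FG.
have /andP[p0 p1] := p01 e.
by apply: lerD; apply: ler_wpM2l; rewrite ?subr_ge0//; apply: ih => w'; apply: FG.
Qed.

Lemma Ex_ge0 s F w : (forall w, 0 <= F w) -> 0 <= Ex s F w.
Proof. by move=> F0; rewrite -(Ex_cst s 0 w); exact: le_Ex. Qed.

Definition le_conf (w w' : K -> bool) := forall e, w e -> w' e.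
Definition increasing_event (A : set (K -> bool)) :=
  forall w w', le_conf w w' -> A w -> A w'.
Definition disjoint_conf (w w' : K -> bool) := forall e, ~~ (w e && w' e).

(** Disjoint occurrence. The witnesses are disjoint sets of open coordinates, which is the usual
    notion for increasing events. *)
Definition box (A B : set (K -> bool)) : set (K -> bool) :=
  [set w | exists I J, [/\ disjoint_conf I J, le_conf I w, le_conf J w, A I & B J]].

Lemma box_increasing A B : increasing_event (box A B).
Proof.
move=> w w' ww' [I [J [dIJ Iw Jw AI BJ]]]; exists I, J; split=> // e.
  by move/Iw/ww'.
by move/Jw/ww'.
Qed.

(* The pairs (I, J) range over a general increasing family W rather than a
   rectangle A x B: the induction on the coordinates leaves rectangles. *)
Let disj (W : (K -> bool) -> (K -> bool) -> Prop) : set (K -> bool) :=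
  [set w | exists I J, [/\ disjoint_conf I J, le_conf I w, le_conf J w & W I J]].

Let increasing2 (W : (K -> bool) -> (K -> bool) -> Prop) :=
  forall I I' J J', le_conf I I' -> le_conf J J' -> W I J -> W I' J'.

Lemma le_conf_upd I I' e (b b' : bool) : le_conf I I' -> (b -> b') ->
  le_conf (upd I e b) (upd I' e b').
Proof. by move=> II' bb' e'; rewrite /upd; case: ifP => _; [exact: bb'|exact: II']. Qed.

Lemma upd_id I e : upd I e (I e) = I.
Proof. by apply/funext => e'; rewrite /upd; case: eqP => // ->. Qed.

Lemma upd_upd I e b c : upd (upd I e b) e c = upd I e c.
Proof. by apply/funext => e'; rewrite /upd; case: eqP. Qed.

(** One configuration shared by disjoint witnesses is traded for two independent ones, coordinate by
    coordinate. At [e], the comparison follows from inclusion-exclusion over the two ways of giving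
    [e] to one witness, and from monotonicity. *)
Lemma bk_pairs s W w : increasing2 W ->
  Ex s (fun w => ind (disj W w)) w
    <= Ex s (fun w1 => Ex s (fun w2 => ind (W w1 w2)) w) w.
Proof.
elim: s W => [|e s ih] W incW /=.
  by apply: ind_le => -[I [J [_ Iw Jw]]]; exact: incW.
set W' := fun i j I J => W (upd I e i) (upd J e j).
have incW' i j : increasing2 (W' i j).
  by move=> I I' J J' II' JJ'; apply: incW; exact: le_conf_upd.
(* If [e] is open, disjoint witnesses use it at most once. By monotonicity it may be handed to
   exactly one of them, and [U] collects both choices. *)
pose U I J := W' true false I J \/ W' false true I J.
have incU : increasing2 U.
  by move=> I I' J J' II' JJ' [] H; [left|right]; exact: incW' H.
pose X I J := W' true false I J /\ W' false true I J.
pose E2 (Z : _ -> _ -> Prop) := Ex s (fun w1 => Ex s (fun w2 => ind (Z w1 w2)) w) w.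
have E2_le (Z Z' : _ -> _ -> Prop) : (forall I J, Z I J -> Z' I J) -> E2 Z <= E2 Z'.
  by move=> ZZ'; apply: le_Ex => w1; apply: le_Ex => w2; apply: ind_le; exact: ZZ'.
have EUX : E2 U + E2 X = E2 (W' true false) + E2 (W' false true).
  rewrite /E2 -!ExD; congr (Ex s _ w); apply/funext => w1.
  by rewrite -!ExD; congr (Ex s _ w); apply/funext => w2; exact: ind_or_and.
have D1 : Ex s (fun w => ind (disj W (upd w e true))) w <= E2 U.
  apply: le_trans (ih _ incU); apply: le_Ex => w'; apply: ind_le.
  move=> -[I [J [dIJ Iw Jw WIJ]]].
  exists (upd I e false), (upd J e false); split.
  - by move=> e'; rewrite /upd; case: (e' == e) => //=; exact: dIJ.
  - by move=> e'; rewrite {1}/upd; case: ifPn => // /negbTE ne /Iw; rewrite /upd ne.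
  - by move=> e'; rewrite {1}/upd; case: ifPn => // /negbTE ne /Jw; rewrite /upd ne.
  - have {}WIJ : W (upd I e (I e)) (upd J e (J e)) by rewrite !upd_id.
    rewrite /U /W' !upd_upd; have := dIJ e; move: WIJ.
    case: (I e) (J e) => -[] // WIJ _; [by left|by right|right].
    by apply: incW WIJ => //; exact: le_conf_upd.
have D0 : Ex s (fun w => ind (disj W (upd w e false))) w <= E2 (W' false false).
  apply: le_trans (ih _ (incW' _ _)); apply: le_Ex => w'; apply: ind_le.
  have upd0 I : le_conf I (upd w' e false) -> upd I e false = I.
    move=> Iw; rewrite -[RHS](upd_id I e); congr upd; apply/esym/negP => /Iw.
    by rewrite /upd eqxx.
  move=> -[I [J [dIJ Iw Jw WIJ]]]; exists I, J; split => //.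
  - by move=> e' /Iw; rewrite /upd; case: ifP.
  - by move=> e' /Jw; rewrite /upd; case: ifP.
  - by rewrite /W' (upd0 I Iw) (upd0 J Jw).
have L11 : E2 U <= E2 (W' true true).
  by apply: E2_le => I J [] H; apply: incW H; exact: le_conf_upd.
have L00 : E2 (W' false false) <= E2 X.
  by apply: E2_le => I J H; split; apply: incW H; exact: le_conf_upd.
rewrite !ExD !ExZ.
change (p e * Ex s (fun w => ind (disj W (upd w e true))) w
  + (1 - p e) * Ex s (fun w => ind (disj W (upd w e false))) w
  <= p e * (p e * E2 (W' true true) + (1 - p e) * E2 (W' true false))
   + (1 - p e) * (p e * E2 (W' false true) + (1 - p e) * E2 (W' false false))).
have /andP[p0 p1] := p01 e; rewrite -subr_ge0 in p1.
apply: le_trans (lerD (ler_wpM2l p0 D1) (ler_wpM2l p1 D0)) _.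
have EF : E2 (W' true false) = E2 U + E2 X - E2 (W' false true) by rewrite EUX addrK.
(* Right side minus left side, once [W' true false] is eliminated by inclusion-exclusion; the two
   terms are nonnegative by [L11] and [L00]. *)
rewrite -subr_ge0 [X in 0 <= X](_ : _ = p e * p e * (E2 (W' true true) - E2 U)
  + p e * (1 - p e) * (E2 X - E2 (W' false false))); last by rewrite EF; ring.
by rewrite addr_ge0 ?mulr_ge0// subr_ge0.
Qed.

Lemma bk_Ex s A B w : increasing_event A -> increasing_event B ->
  Ex s (fun w => ind (box A B w)) w
    <= Ex s (fun w => ind (A w)) w * Ex s (fun w => ind (B w)) w.
Proof.
move=> incA incB; pose W I J := A I /\ B J.
apply: (@le_trans _ _ (Ex s (fun w => ind (disj W w)) w)).
  apply: le_Ex => w'; apply: ind_le => -[I [J [*]]].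
  by exists I, J; split.
apply: le_trans (bk_pairs s _ _) _.
  by move=> I I' J J' II' JJ' [AI BJ]; split; [exact: incA AI|exact: incB BJ].
rewrite le_eqVlt; apply/orP; left; apply/eqP.
rewrite mulrC -ExZ; congr (Ex s _ w); apply/funext => w1.
rewrite mulrC -ExZ; congr (Ex s _ w); apply/funext => w2.
rewrite /ind asbool_and.
by do 2!case: asboolP => _ /=; rewrite ?(mulr0, mul0r, mulr1).
Qed.

End product_expectation.

Definition determined {K : eqType} (s : seq K) (A : set (K -> bool)) :=
  forall w w', {in s, w =1 w'} -> A w -> A w'.

Lemma determined_upd (K : eqType) (e : K) s A b :
  determined (e :: s) A -> determined s [set w | A (upd w e b)].
Proof.
move=> dA w w' ww'; apply: dA => e'; rewrite inE /upd; case: ifP => //= _.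
exact: ww'.
Qed.

(** * Events depending on finitely many edges *)

Section finite_events.
Context {R : realType} {d : nat}.
Variables (P : probability (configuration d) R) (p : edge d -> R).
Hypothesis P_open : forall e, P [set w | w e] = (p e)%:E.
Hypothesis P_indep :
  mutually_independent P (fun e : edge d => [set w : configuration d | w e]).

Let opens (B : {fset edge d}) : set (configuration d) :=
  \bigcap_(e in [set` B]) [set w : configuration d | w e].

Lemma measurable_open (e : edge d) : measurable [set w : configuration d | w e].
Proof. by apply: sub_sigma_algebra; exists e. Qed.

Let measurable_opens B : measurable (opens B).
Proof.
by apply: fin_bigcap_measurable => [|e _]; [exact: finite_fset|exact: measurable_open].
Qed.

Lemma determined_split (e : edge d) (A : set (configuration d)) :
  A = ([set w | A (upd w e true)] `&` [set w | w e])
      `|` ([set w | A (upd w e false)] `\` [set w | w e]).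
Proof.
apply/seteqP; split => w /=.
  move=> Aw; case we: (w e); [left|right]; split=> //.
    by rewrite -we upd_id.
  by rewrite -we upd_id.
by case=> -[Aw]; [move=> we|move/negP/negbTE => we]; move: Aw; rewrite -{1}we upd_id.
Qed.

Lemma determined_measurable s (A : set (configuration d)) :
  determined s A -> measurable A.
Proof.
elim: s A => [|e s ih] A dA.
  have [[w Aw]|nA] := pselect (exists w, A w).
    suff -> : A = setT by exact: measurableT.
    by apply/seteqP; split => // w' _; exact: dA Aw.
  suff -> : A = set0 by exact: measurable0.
  by apply/seteqP; split => // w' Aw'; apply: nA; exists w'.
rewrite (determined_split e A).
apply: measurableU; [apply: measurableI|apply: measurableD];
  by [exact: measurable_open|apply: ih; exact: determined_upd].
Qed.

(** Independence is given only for events that edges are open. Requiring [e] to be open adds it to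
    [B], and the case of a closed [e] is a difference of two such events; hence the induction on [s]
    runs over all [B] that avoid [s]. *)
Let P_determined_opens s (A : set (configuration d)) (B : {fset edge d}) w0 :
  uniq s -> determined s A -> {in s, forall e, e \notin B} ->
  P (A `&` opens B) = (Ex p s (fun w => ind (A w)) w0 * \prod_(e <- B) p e)%:E.
Proof.
elim: s A B => [|e s ih] A B /=.
  move=> _ dA _.
  have PB : P (opens B) = (\prod_(e <- B) p e)%:E.
    by rewrite P_indep -prodEFin; apply: eq_bigr => e _; exact: P_open.
  have [Aw|nAw] := pselect (A w0).
    have -> : A = setT by apply/seteqP; split => // w' _; exact: dA Aw.
    by rewrite setTI PB ind_true ?mul1r.
  have -> : A = set0 by apply/seteqP; split => // w' Aw'; apply: nAw; exact: dA Aw'.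
  by rewrite set0I measure0 ind_false ?mul0r.
move=> /andP[es us] dA sB.
have eB : e \notin B by apply: sB; rewrite mem_head.
have sB' : {in s, forall e, e \notin B} by move=> e' e's; apply: sB; rewrite inE e's orbT.
have sBe : {in s, forall e', e' \notin (e |` B)%fset}.
  move=> e' e's; rewrite !inE negb_or sB' // andbT; apply: contraNneq es => <- //.
set A1 := [set w : configuration d | A (upd w e true)].
set A0 := [set w : configuration d | A (upd w e false)].
have d1 : determined s A1 := determined_upd dA.
have d0 : determined s A0 := determined_upd dA.
have opensU : opens (e |` B)%fset = [set w : configuration d | w e] `&` opens B.
  apply/seteqP; split => w.
    move=> H; split; first by apply: H => /=; rewrite !inE eqxx.
    by move=> e' e'B; apply: H => /=; rewrite !inE orbC (_ : e' \in B).
  by move=> [we H] e' /=; rewrite !inE => /orP[/eqP ->//|]; exact: H.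
have m1 := determined_measurable d1.
have m0 := determined_measurable d0.
have prodU : \prod_(e' <- (e |` B)%fset) p e' = p e * \prod_(e <- B) p e.
  by rewrite big_fsetU1.
have -> : A `&` opens B = (A1 `&` opens (e |` B)%fset)
    `|` ((A0 `&` opens B) `\` (A0 `&` opens (e |` B)%fset)).
  rewrite {1}(determined_split e A) -/A1 -/A0 opensU; apply/seteqP; split => w /=.
    by move=> [[[? ?]|[? ?]] ?]; [left|right]; intuition.
  move=> [[? [? ?]]|[[? ?] H]]; first by split => //; left.
  split=> //; right; split => // we; apply: H; by intuition.
have mI (C : set (configuration d)) (D : {fset edge d}) :
  measurable C -> measurable (C `&` opens D) by move=> ?; exact: measurableI.
have PU (X Y : set (configuration d)) : measurable X -> measurable Y ->
  X `&` Y = set0 -> P (X `|` Y) = (P X + P Y)%E by exact: measureU.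
have PD (X Y : set (configuration d)) : measurable X -> measurable Y ->
  P (X `\` Y) = (P X - P (X `&` Y))%E.
  move=> mX mY; apply: measureD => //.
  by rewrite (le_lt_trans (probability_le1 _ _)) ?ltry.
rewrite PU; [|exact: mI|by apply: measurableD; exact: mI|]; last first.
  by rewrite opensU; apply/seteqP; split => w //= [[? [? ?]] [[? ?]]]; intuition.
rewrite PD; [|exact: mI|exact: mI].
have -> : (A0 `&` opens B) `&` (A0 `&` opens (e |` B)%fset) = A0 `&` opens (e |` B)%fset.
  rewrite opensU; apply/seteqP; split => w /=; intuition.
rewrite !ih// prodU -EFinB -EFinD; congr (_%:E); rewrite /A1 /A0 /=; ring.
Qed.

Lemma P_determined s (A : set (configuration d)) w0 : uniq s -> determined s A ->
  P A = (Ex p s (fun w => ind (A w)) w0)%:E.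
Proof.
move=> us dA; have := @P_determined_opens s A fset0 w0 us dA.
rewrite big_seq_fset0 mulr1 (_ : opens fset0 = setT) ?setIT; first by apply.
by apply/seteqP; split => // w _ e.
Qed.
End finite_events.

(** * Connectivity and tree splitting *)

Section connectivity.
Context {T : choiceType}.
Implicit Types (e : rel T) (X Y : {fset T}) (x y z : T).

Definition conn e X x y : Prop :=
  exists p, [/\ path e x p, last x p = y & {subset x :: p <= X}].

(** The cluster of [x] inside [X]; it is empty when [x] lies outside [X]. *)
Definition cl e X x : {fset T} := [fset y in X | `[< conn e X x y >]]%fset.

Lemma conn_in e X x y : conn e X x y -> x \in X /\ y \in X.
Proof.
by move=> [p [_ <- pX]]; split; apply: pX; rewrite ?mem_head ?mem_last.
Qed.

Lemma mem_cl e X x y : reflect (conn e X x y) (y \in cl e X x).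
Proof.
apply: (iffP idP); first by rewrite !inE => /andP[_ /asboolP].
by move=> c; rewrite !inE (conn_in c).2; apply/asboolP.
Qed.

Lemma conn_refl e X x : x \in X -> conn e X x x.
Proof. by move=> xX; exists [::]; split=> // y; rewrite inE => /eqP ->. Qed.

Lemma conn1 e X x y : x \in X -> y \in X -> e x y -> conn e X x y.
Proof.
move=> xX yX exy; exists [:: y]; split=> //=; first by rewrite exy.
by move=> z; rewrite !inE => /orP[] /eqP ->.
Qed.

Lemma conn_trans e X x y z : conn e X x y -> conn e X y z -> conn e X x z.
Proof.
move=> [p [ep <- pX]] [q [eq <- qX]]; exists (p ++ q); split.
- by rewrite cat_path ep.
- by rewrite last_cat.
- move=> u; rewrite -cat_cons mem_cat => /orP[/pX//|uq].
  by apply: qX; rewrite inE uq orbT.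
Qed.

Lemma conn_sym e X x y : symmetric e -> conn e X x y -> conn e X y x.
Proof.
move=> se [p [ep <- pX]]; exists (rev (belast x p)); split.
- rewrite rev_path; rewrite (eq_path (e' := e)) // => u v; exact: se.
- by case: p {ep pX} => //= z p; rewrite rev_cons last_rcons.
- move=> u; rewrite inE mem_rev => /orP[/eqP ->|/mem_belast]; last exact: pX.
  by apply: pX; rewrite mem_last.
Qed.

Lemma conn_mono e e' X Y x y : (forall u v, u \in X -> v \in X -> e u v -> e' u v) ->
  {subset X <= Y} -> conn e X x y -> conn e' Y x y.
Proof.
move=> ee' XY [p [ep lp pX]]; exists p; split=> //; last by move=> z /pX/XY.
elim: p x pX ep {lp} => //= z p ih x pX /andP[exz ep].
have zX u : u \in z :: p -> u \in X by move=> uz; apply: pX; rewrite inE uz orbT.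
rewrite /= ih ?ep// andbT; apply: ee' exz; first by rewrite pX ?mem_head.
by apply: zX; rewrite mem_head.
Qed.

(* [Graft t1 t2] adds [t2] as a new subtree below the root of [t1]. *)
Inductive tree := Leaf of T | Graft of tree & tree.

Fixpoint troot t := match t with Leaf v => v | Graft t1 _ => troot t1 end.
Fixpoint verts t :=
  match t with Leaf v => [:: v] | Graft t1 t2 => verts t1 ++ verts t2 end.
Fixpoint tree_ok e t :=
  match t with
  | Leaf _ => true
  | Graft t1 t2 => [&& tree_ok e t1, tree_ok e t2 & e (troot t1) (troot t2)]
  end.

Lemma troot_verts t : troot t \in verts t.
Proof. by elim: t => [v|t1 i1 t2 i2] /=; rewrite ?mem_head// mem_cat i1. Qed.

Lemma tree_conn e X t : tree_ok e t -> {subset verts t <= X} ->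
  forall x, x \in verts t -> conn e X (troot t) x.
Proof.
elim: t => [v|t1 i1 t2 i2] /= => [_ vX x|/and3P[ok1 ok2 e12] tX x].
  by rewrite inE => /eqP ->; apply: conn_refl; apply: vX; rewrite mem_head.
have X1 : {subset verts t1 <= X} by move=> y y1; apply: tX; rewrite mem_cat y1.
have X2 : {subset verts t2 <= X} by move=> y y2; apply: tX; rewrite mem_cat y2 orbT.
rewrite mem_cat => /orP[x1|x2]; first exact: i1.
apply: conn_trans (i2 _ _ _ x2) => //.
by apply: conn1 e12; [apply: X1|apply: X2]; exact: troot_verts.
Qed.

Lemma tree_cl e X t : tree_ok e t -> {subset verts t <= X} -> uniq (verts t) ->
  (size (verts t) <= #|` cl e X (troot t)|)%N.
Proof.
move=> ok tX ut; apply: uniq_leq_size => // x xt.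
by apply/mem_cl; exact: tree_conn.
Qed.

Let arith1 a b c r k : (a <= c -> b <= c -> a + b <= c + r ->
  [/\ a <= c + k, b + k <= c + k & a + (b + k) <= c + k + r])%N.
Proof. by move=> *; split; lia. Qed.

Let arith2 a b c r k : (a <= c -> b <= c -> a + b <= c + r ->
  [/\ a <= k + c, k + b <= k + c & a + (k + b) <= k + c + r])%N.
Proof. by move=> *; split; lia. Qed.

(** Descend into a half with at least [L] vertices until neither half has that many: what remains
    has fewer than [2 L] vertices and becomes [A]. Its root [r] is also left in [B], which keeps [B]
    connected. Counting multiplicities spares the induction any uniqueness hypothesis. *)
Lemma tree_split e L t : (0 < L)%N -> tree_ok e t -> (L <= size (verts t))%N ->
  exists A B r, [/\ tree_ok e A /\ tree_ok e B, troot B = troot t,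
    (L <= size (verts A))%N && (size (verts A) < L.*2)%N,
    (size (verts t) <= size (verts A) + size (verts B))%N &
    forall x, [/\ count_mem x (verts A) <= count_mem x (verts t),
      count_mem x (verts B) <= count_mem x (verts t) &
      count_mem x (verts A) + count_mem x (verts B)
        <= count_mem x (verts t) + (x == r)]%N].
Proof.
move=> L0; elim: t => [v|t1 i1 t2 i2] /=.
  move=> _ L1; exists (Leaf v), (Leaf v), v; split=> //=; first lia.
  by move=> x; rewrite !addn0 eq_sym; split.
move=> /and3P[ok1 ok2 e12]; rewrite size_cat => Lt.
have [L2|L2] := leqP L (size (verts t2)).
  have [A [B [r [[okA okB] rB LA sz cnt]]]] := i2 ok2 L2.
  exists A, (Graft t1 B), r; split=> //=.
  - by split=> //; rewrite ok1 okB rB.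
  - by rewrite size_cat; lia.
  - by move=> x; rewrite !count_cat; case: (cnt x); exact: arith2.
have [L1|L1] := leqP L (size (verts t1)).
  have [A [B [r [[okA okB] rB LA sz cnt]]]] := i1 ok1 L1.
  exists A, (Graft B t2), r; split=> //=.
  - by split=> //; rewrite ok2 okB rB.
  - by rewrite size_cat; lia.
  - by move=> x; rewrite !count_cat; case: (cnt x); exact: arith1.
have troot_count x : ((troot t1 == x) <= count_mem x (verts t1))%N.
  by case: eqP => // <-; rewrite -has_count has_pred1 troot_verts.
exists (Graft t1 t2), (Leaf (troot t1)), (troot t1); split=> //=.
- by rewrite ok1 ok2.
- by rewrite size_cat; lia.
- by rewrite size_cat; lia.
- move=> x; rewrite addn0 [x == _]eq_sym; split=> //; rewrite count_cat.
  exact: leq_trans (troot_count x) (leq_addr _ _).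
Qed.

Fixpoint insert t x y :=
  match t with
  | Leaf v => if v == x then Graft t (Leaf y) else t
  | Graft t1 t2 =>
    if x \in verts t1 then Graft (insert t1 x y) t2 else Graft t1 (insert t2 x y)
  end.

Lemma insertP e t x y : x \in verts t -> e x y -> tree_ok e t ->
  [/\ tree_ok e (insert t x y), troot (insert t x y) = troot t
    & perm_eq (verts (insert t x y)) (y :: verts t)].
Proof.
move=> + exy; elim: t => [v|t1 i1 t2 i2] /=.
  rewrite inE => /eqP <- _; rewrite eqxx; split=> //=.
  by rewrite (perm_catC [:: x] [:: y]).
rewrite mem_cat; case: ifPn => /= [x1 _|_ x2] /and3P[ok1 ok2 e12].
  have [ok r prm] := i1 x1 ok1; rewrite ok r ok2 e12; split=> //.
  by rewrite (perm_cat2r (verts t2) _ (y :: verts t1)).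
have [ok r prm] := i2 x2 ok2; rewrite ok r ok1 e12; split=> //.
rewrite -cat1s perm_sym perm_catCA perm_sym.
by rewrite (perm_cat2l (verts t1)).
Qed.

Lemma path_exit e (A : pred T) x p : path e x p -> A x -> ~~ A (last x p) ->
  exists u v, [/\ u \in x :: p, v \in x :: p, e u v, A u & ~~ A v].
Proof.
elim: p x => [|z p ih] x /=; first by move=> _ ->.
move=> /andP[exz ep] Ax nA; have [Az|nAz] := boolP (A z).
  have [u [v [uz vz euv Au nAv]]] := ih z ep Az nA.
  by exists u, v; split=> //; rewrite inE ?uz ?vz orbT.
by exists x, z; split=> //; rewrite !inE eqxx ?orbT.
Qed.

(** The tree grows one vertex at a time: as long as it misses a vertex of the cluster, a path to
    that vertex crosses an edge leaving the tree. *)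
Lemma cl_tree e X x n : (0 < n <= #|` cl e X x|)%N ->
  exists t, [/\ tree_ok e t, troot t = x, size (verts t) = n, uniq (verts t)
    & {subset verts t <= X}].
Proof.
elim: n => // -[_ /= n1|n ih /= nX].
  exists (Leaf x); split=> // y; rewrite inE => /eqP ->.
  have [z /mem_cl/conn_in[]//] : exists z, z \in cl e X x.
  by apply/fset0Pn; rewrite -cardfs_gt0.
have [t [ok tx szt ut tX]] := ih (ltnW nX).
have [y ycl yt] : exists2 y, y \in cl e X x & y \notin verts t.
  apply/hasP; rewrite has_predC; apply/negP => /allP sub.
  by have := uniq_leq_size (fset_uniq (cl e X x)) sub; rewrite szt leqNgt nX.
have /mem_cl[p [ep lp pX]] := ycl.
have xt : x \in verts t by rewrite -tx troot_verts.
have := @path_exit e (mem (verts t)) x p ep xt; rewrite lp => /(_ yt).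
move=> [u [v [_ vp euv ut' vt]]].
have [ok' tx' prm] := insertP ut' euv ok.
exists (insert t u v); split=> //.
- by rewrite tx'.
- by rewrite (perm_size prm) /= szt.
- by rewrite (perm_uniq prm) /= vt ut.
- by move=> z; rewrite (perm_mem prm) inE => /orP[/eqP ->|/tX//]; exact: pX.
Qed.

(** Cut a tree with exactly [3 L] vertices: the first piece has between [L] and [2 L - 1] of them,
    so at least [L] are left for the second. *)
Lemma cl_split e X x L : (0 < L)%N -> (3 * L <= #|` cl e X x|)%N ->
  exists (Y Z : {fset T}) r y z, [/\ {subset Y <= X}, {subset Z <= X},
    forall u, u \in Y -> u \in Z -> u = r,
    (L <= #|` cl e Y y|)%N & (L <= #|` cl e Z z|)%N].
Proof.
move=> L0 LX.
have [t [ok _ szt ut tX]] : exists t, [/\ tree_ok e t, troot t = x,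
    size (verts t) = (3 * L)%N, uniq (verts t) & {subset verts t <= X}].
  by apply: cl_tree; rewrite LX muln_gt0 L0.
have Lt : (L <= size (verts t))%N by rewrite szt; lia.
have [A [B [r [[okA okB] _ /andP[LA AL] sz cnt]]]] := tree_split L0 ok Lt.
have count1 z : (count_mem z (verts t) <= 1)%N.
  by rewrite count_uniq_mem //; case: (_ \in _).
have memE (s : seq T) z : (z \in s) = (0 < count_mem z s)%N.
  by rewrite -has_count has_pred1.
have sub_uniq (s : seq T) : (forall z, count_mem z s <= count_mem z (verts t))%N ->
    {subset s <= verts t} /\ uniq s.
  move=> st; split=> [z|]; first by rewrite !memE => /leq_trans; exact.
  apply: count_mem_uniq => z; rewrite memE.
  by have := leq_trans (st z) (count1 z); case: (count_mem z s) => [|[]].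
have uA : {subset verts A <= verts t} /\ uniq (verts A).
  by apply: sub_uniq => z; case: (cnt z).
have uB : {subset verts B <= verts t} /\ uniq (verts B).
  by apply: sub_uniq => z; case: (cnt z).
exists [fset u in verts A]%fset, [fset u in verts B]%fset, r, (troot A), (troot B).
split.
- by move=> u; rewrite !inE => /uA.1/tX.
- by move=> u; rewrite !inE => /uB.1/tX.
- move=> u; rewrite !inE !memE => uA0 uB0; apply: contraTeq (leq_add uA0 uB0) => /negbTE ur.
  by have [_ _] := cnt u; rewrite ur addn0 -ltnNge => /leq_ltn_trans; apply; exact: count1.
- apply: (leq_trans LA); apply: tree_cl => //; last exact: uA.2.
  by move=> u; rewrite inE.
- apply: leq_trans (tree_cl okB _ uB.2); first lia.
  by move=> u; rewrite inE.
Qed.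

End connectivity.

(** * Finite-volume percolation *)

Section open_graph.
Context {d : nat}.
Local Notation V := 'rV[int]_d.
Implicit Types (w : configuration d) (X Y S : {fset V}) (x y z : V).

Lemma open_adjP w x y :
  reflect (exists2 e : edge d, val e = [fset x; y]%fset & w e) (open_adj w x y).
Proof.
rewrite /open_adj; apply: (iffP idP) => [|[e ve we]].
  by case: insubP => // e _ ve we; exists e.
by rewrite -ve valK.
Qed.

Lemma open_adj_sym w : symmetric (open_adj w).
Proof. by move=> x y; rewrite /open_adj fsetUC. Qed.

Lemma open_adj_mono w w' x y : le_conf w w' -> open_adj w x y -> open_adj w' x y.
Proof.
by move=> ww' /open_adjP[e ve we]; apply/open_adjP; exists e => //; exact: ww'.
Qed.

Lemma edgeP (e : edge d) : exists x y, x != y /\ val e = [fset x; y]%fset.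
Proof.
case: e => /= A /eqP A2.
have /fset0Pn[x xA] : A != fset0 by rewrite -cardfs_gt0 A2.
have /cardfs1P[y Ay] : #|` (A `\ x)%fset| == 1%N.
  by have := cardfsD1 x A; rewrite A2 xA add1n => -[<-].
exists x, y; split; last by rewrite -Ay fsetD1K.
by apply/negP => /eqP xy; have := fset11 y; rewrite -Ay !inE xy eqxx.
Qed.

Definition restr w X : configuration d := fun e => w e && (val e `<=` X)%fset.

Lemma restr_le w X : le_conf (restr w X) w.
Proof. by move=> e /andP[]. Qed.

Lemma restr_adj w X x y : x \in X -> y \in X -> open_adj w x y ->
  open_adj (restr w X) x y.
Proof.
move=> xX yX /open_adjP[e ve we]; apply/open_adjP; exists e => //.
rewrite /restr we /= ve; apply/fsubsetP => z.
by rewrite !inE => /orP[] /eqP ->.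
Qed.

Lemma conn_restr w X x y : conn (open_adj w) X x y -> conn (open_adj (restr w X)) X x y.
Proof. by apply: conn_mono => // u v uX vX; exact: restr_adj. Qed.

(** An edge has two distinct ends, so vertex sets with at most one common point span disjoint sets
    of edges. *)
Lemma disjoint_restr w X Y r : (forall u, u \in X -> u \in Y -> u = r) ->
  disjoint_conf (restr w X) (restr w Y).
Proof.
move=> XYr e; apply/negP => /andP[/andP[_ eX] /andP[_ eY]].
have [x [y [xy ve]]] := edgeP e; move: xy.
have xe : x \in val e by rewrite ve !inE eqxx.
have ye : y \in val e by rewrite ve !inE eqxx orbT.
have xr := XYr x (fsubsetP eX _ xe) (fsubsetP eY _ xe).
have yr := XYr y (fsubsetP eX _ ye) (fsubsetP eY _ ye).
by rewrite xr yr eqxx.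
Qed.

Definition inner_edges X : seq (edge d) :=
  undup (pmap insub [seq [fset x; y]%fset | x <- X, y <- X]).

Lemma mem_inner_edges X e : (e \in inner_edges X) = (val e `<=` X)%fset.
Proof.
rewrite mem_undup mem_pmap_sub; apply/allpairsP/idP => [[[x y] /= [xX yX ->]]|].
  by apply/fsubsetP => z; rewrite !inE => /orP[] /eqP ->.
have [x [y [_ ->]]] := edgeP e => /fsubsetP eX; exists (x, y) => /=; split=> //;
  by apply: eX; rewrite !inE eqxx ?orbT.
Qed.

Lemma uniq_inner_edges X : uniq (inner_edges X).
Proof. exact: undup_uniq. Qed.

Definition conn_ev X x y : set (configuration d) := [set w | conn (open_adj w) X x y].
Definition cl_ge X x k : set (configuration d) :=
  [set w | (k <= #|` cl (open_adj w) X x|)%N].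
Definition max_ge X k : set (configuration d) := [set w | exists x, cl_ge X x k w].

Lemma inner_adj X w w' : {in inner_edges X, w =1 w'} ->
  forall x y, x \in X -> y \in X -> open_adj w x y -> open_adj w' x y.
Proof.
move=> ww' x y xX yX /open_adjP[e ve we]; apply/open_adjP; exists e => //.
rewrite -ww' // mem_inner_edges ve; apply/fsubsetP => z.
by rewrite !inE => /orP[] /eqP ->.
Qed.

Lemma conn_ev_determined X x y : determined (inner_edges X) (conn_ev X x y).
Proof. by move=> w w' ww'; apply: conn_mono => //; exact: inner_adj. Qed.

Lemma conn_ev_increasing X x y : increasing_event (conn_ev X x y).
Proof. by move=> w w' ww'; apply: conn_mono => // u v _ _; exact: open_adj_mono. Qed.

Lemma cl_mono w w' X Y x :
  (forall u v, u \in X -> v \in X -> open_adj w u v -> open_adj w' u v) ->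
  {subset X <= Y} ->
  (#|` cl (open_adj w) X x| <= #|` cl (open_adj w') Y x|)%N.
Proof.
move=> ww' XY; apply/fsubset_leq_card/fsubsetP => z /mem_cl c.
by apply/mem_cl; exact: conn_mono c.
Qed.

Lemma cl_ge_determined X x k : determined (inner_edges X) (cl_ge X x k).
Proof. by move=> w w' /inner_adj ww' /leq_trans; apply; exact: cl_mono. Qed.

Lemma cl_ge_increasing X x k : increasing_event (cl_ge X x k).
Proof.
by move=> w w' ww' /leq_trans; apply; apply: cl_mono => // u v _ _; exact: open_adj_mono.
Qed.

Lemma max_ge_increasing X k : increasing_event (max_ge X k).
Proof. by move=> w w' ww' [x wx]; exists x; exact: cl_ge_increasing wx. Qed.

Lemma max_ge_box X L : (0 < L)%N ->
  max_ge X (3 * L) `<=` box (max_ge X L) (max_ge X L).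
Proof.
move=> L0 w [x wx]; have [Y [Z [r [y [z [YX ZX YZ yL zL]]]]]] := cl_split L0 wx.
exists (restr w Y), (restr w Z); split; try exact: restr_le.
- exact: disjoint_restr YZ.
- exists y; apply: (leq_trans yL); apply/fsubset_leq_card/fsubsetP => u /mem_cl c.
  by apply/mem_cl; apply: conn_mono (conn_restr c).
- exists z; apply: (leq_trans zL); apply/fsubset_leq_card/fsubsetP => u /mem_cl c.
  by apply/mem_cl; apply: conn_mono (conn_restr c).
Qed.

End open_graph.

Section finite_volume.
Context {R : realType} {d : nat}.
Local Notation V := 'rV[int]_d.
Variable (p : edge d -> R).
Hypothesis p01 : forall e, 0 <= p e <= 1.
Implicit Types (X : {fset V}).

(** Finite-volume probability, with all edges not inside [X] closed. For events determined by the
    edges inside [X] it agrees with the percolation measure, see [P_pr]. *)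
Definition pr X (A : set (configuration d)) : R :=
  Ex p (inner_edges X) (fun w => ind (A w)) (fun=> false).

Lemma pr_ge0 X A : 0 <= pr X A.
Proof. by apply: Ex_ge0 => // w; exact: ind_ge0. Qed.

Lemma pr_le X A B : A `<=` B -> pr X A <= pr X B.
Proof. by move=> AB; apply: le_Ex => // w; apply: ind_le; exact: AB. Qed.

Lemma pr_le1 X A : pr X A <= 1.
Proof.
rewrite -(Ex_cst p (inner_edges X) 1 (fun=> false)).
by apply: le_Ex => // w; exact: ind_le1.
Qed.

Lemma pr_bk X A B : increasing_event A -> increasing_event B ->
  pr X (box A B) <= pr X A * pr X B.
Proof. by move=> iA iB; exact: bk_Ex. Qed.

Lemma pr_max_ge_sq X L : (0 < L)%N ->
  pr X (max_ge X (3 * L)) <= pr X (max_ge X L) ^+ 2.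
Proof.
move=> L0; apply: le_trans (pr_le X (max_ge_box L0)) _.
by apply: pr_bk; exact: max_ge_increasing.
Qed.

Lemma pr_max_ge_exp X L j : (0 < L)%N ->
  pr X (max_ge X (3 ^ j * L)) <= pr X (max_ge X L) ^+ (2 ^ j).
Proof.
move=> L0; elim: j => [|j ih]; first by rewrite expn0 mul1n expr1.
rewrite expnS -mulnA; apply: le_trans (pr_max_ge_sq _ _) _.
  by rewrite muln_gt0 L0 expn_gt0.
by rewrite expnSr exprM lerXn2r ?nnegrE ?pr_ge0 ?exprn_ge0 ?pr_ge0.
Qed.

(** A cluster with at least [M] vertices contributes each of its vertices to the sum on the
    right. *)
Lemma pr_max_ge_markov X M :
  M%:R * pr X (max_ge X M) <= \sum_(x <- X) pr X (cl_ge X x M).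
Proof.
rewrite -Ex_sum -ExZ; apply: le_Ex => // w.
have [[x wx]|nw] := pselect (max_ge X M w); last first.
  by rewrite (ind_false nw) mulr0 sumr_ge0 // => x _; exact: ind_ge0.
rewrite ind_true ?mulr1; last by exists x.
apply: (@le_trans _ _ (\sum_(y <- cl (open_adj w) X x) 1)).
  by rewrite big_const_seq count_predT iter_addr_0 ler_nat.
rewrite [leRHS](big_fsetID _ (mem (cl (open_adj w) X x))) /=.
apply: ler_wpDr; first by rewrite sumr_ge0 // => y _; exact: ind_ge0.
have -> : [fset y in X | y \in cl (open_adj w) X x]%fset = cl (open_adj w) X x.
  apply/fsetP => y; rewrite !inE /=.
  by apply/andP/andP => -[// yX]; rewrite ?yX.
rewrite big_seq [leRHS]big_seq; apply: ler_sum => y ycl.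
suff ywM : cl_ge X y M w by rewrite (ind_true ywM).
apply: (leq_trans wx); apply/fsubset_leq_card/fsubsetP => z /mem_cl xz.
have /mem_cl xy := ycl; apply/mem_cl.
by apply: conn_trans xz; apply: conn_sym xy; exact: open_adj_sym.
Qed.

Lemma cl_size_ind (w : configuration d) X x :
  (#|` cl (open_adj w) X x|)%:R = \sum_(y <- X) ind (R := R) (conn_ev X x y w).
Proof.
rewrite (big_fsetID _ (mem (cl (open_adj w) X x))) /=.
have -> : [fset y in X | y \in cl (open_adj w) X x]%fset = cl (open_adj w) X x.
  apply/fsetP => y; rewrite !inE /=.
  by apply/andP/andP => -[// yX]; rewrite ?yX.
rewrite [X in _ + X]big_seq [X in _ + X]big1 ?addr0; last first.
  move=> y; rewrite !inE /= => /andP[yX]; rewrite yX /= => /asboolPn nc.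
  by rewrite ind_false.
rewrite big_seq (eq_bigr (fun=> 1)); last first.
  by move=> y /mem_cl c; rewrite ind_true.
by rewrite -big_seq big_const_seq count_predT iter_addr_0.
Qed.

(** When all clusters have fewer than [M] vertices, the cluster size is the sum of the indicators
    that it is at least [k + 1], for [k < M]; otherwise it is bounded by the volume of [X]. *)
Lemma expected_cl_le X x M :
  \sum_(y <- X) pr X (conn_ev X x y)
    <= \sum_(k < M) pr X (cl_ge X x k.+1) + (#|` X|)%:R * pr X (max_ge X M).
Proof.
rewrite -!Ex_sum -ExZ -ExD; apply: le_Ex => // w.
rewrite -cl_size_ind.
have [[y wy]|nw] := pselect (max_ge X M w).
  rewrite (ind_true (Q := max_ge X M w)) ?mulr1; last by exists y.
  apply: ler_wpDl; first by rewrite sumr_ge0 // => k _; exact: ind_ge0.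
  by rewrite ler_nat fsubset_leq_card //; apply/fsubsetP => z /mem_cl/conn_in[].
rewrite (ind_false nw) mulr0 addr0.
set n := #|` _|; have nM : (n <= M)%N.
  by rewrite leqNgt; apply/negP => /ltnW Mn; apply: nw; exists x.
rewrite -(subnKC nM) big_split_ord /=; apply: ler_wpDr.
  by rewrite sumr_ge0 // => k _; exact: ind_ge0.
rewrite (eq_bigr (fun=> 1)) ?sumr_const ?card_ord // => k _.
by rewrite ind_true //; exact: ltn_ord.
Qed.

End finite_volume.

(** * Sharpness of the phase transition *)

Lemma uniq_path_exit (T : eqType) (A : pred T) (x : T) p : A x -> ~~ A (last x p) ->
  exists p1 y p2, [/\ p = p1 ++ y :: p2, all A (x :: p1) & ~~ A y].
Proof.
elim: p x => [|z p ih] x /= Ax; first by rewrite Ax.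
have [Az|nAz] := boolP (A z) => nA; last first.
  by exists [::], z, p; split=> //=; rewrite Ax.
have [p1 [y [p2 [-> Ap1 nAy]]]] := ih z Az nA.
by exists (z :: p1), y, p2; split=> //=; rewrite Ax.
Qed.

Lemma determined_sub (K : eqType) (s s' : seq K) (A : set (K -> bool)) :
  {subset s <= s'} -> determined s A -> determined s' A.
Proof. by move=> ss' dA w w' ww'; apply: dA => e /ss'; exact: ww'. Qed.

(** * First exit of an open path from a finite set *)

Section first_exit.
Context {d : nat}.
Local Notation V := 'rV[int]_d.
Implicit Types (w : configuration d) (X Y S : {fset V}) (x y z : V).

Definition adj_ev x y : set (configuration d) := [set w | open_adj w x y].

Lemma adj_ev_increasing x y : increasing_event (adj_ev x y).
Proof. by move=> w w' ww'; exact: open_adj_mono. Qed.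

Lemma path_restr w X x p : {subset x :: p <= X} -> path (open_adj w) x p ->
  path (open_adj (restr w X)) x p.
Proof.
elim: p x => //= z p ih x pX /andP[xz zp].
have zX : {subset z :: p <= X} by move=> u uz; apply: pX; rewrite inE uz orbT.
rewrite ih // andbT; apply: restr_adj xz; [apply: pX|apply: zX]; exact: mem_head.
Qed.

(** Let [y] be the first vertex outside [S] on a self-avoiding open path and [x] the vertex before
    it. The part up to [x], the edge from [x] to [y] and the part after [y] share no edge. The last
    part may return to [S]. *)
Lemma conn_first_exit w X S v z : v \in S -> z \notin S -> conn (open_adj w) X v z ->
  exists2 x, x \in S & exists2 y, (y \in X) && (y \notin S) &
    box (conn_ev S v x) (box (adj_ev x y) (conn_ev X y z)) w.
Proof.
move=> vS zS [p' [wp' lp' p'X]].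
(* Loop erasure: disjointness of the three parts needs a path without repeated vertices. *)
have [p [wp lp up pX]] : exists p, [/\ path (open_adj w) v p, last v p = z,
    uniq (v :: p) & {subset v :: p <= X}].
  move: lp'; case: (shortenP wp') => p wp up pp' lp; exists p; split=> // u.
  by rewrite inE => /orP[/eqP ->|/pp' up']; apply: p'X; rewrite ?mem_head// inE up' orbT.
have zS' : ~~ (mem S) (last v p) by rewrite lp.
have [p1 [y [p2 [pE p1S yS]]]] := uniq_path_exit vS zS'.
have {}up : uniq ((v :: p1) ++ y :: p2) by move: up; rewrite pE.
have {}pX : {subset (v :: p1) ++ y :: p2 <= X} by move: pX; rewrite pE.
move: wp up lp; rewrite pE cat_path last_cat cat_uniq.
move=> /andP[wp1 /andP[xy wp2]] /and3P[up1 /hasPn p12 up2] lp.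
have {}p12 u : u \in y :: p2 -> u \notin v :: p1 by exact: p12.
set x := last v p1.
have xp1 : x \in v :: p1 := mem_last v p1.
exists x; first exact: (allP p1S).
exists y; first by rewrite yS pX // mem_cat mem_head orbT.
have mem1 u : (u \in [fset u in v :: p1]%fset) = (u \in v :: p1) by rewrite !inE.
set F := [fset u in x :: y :: p2]%fset; set G := [fset u in y :: p2]%fset.
have memF u : (u \in F) = (u \in x :: y :: p2) by rewrite !inE.
have memG u : (u \in G) = (u \in y :: p2) by rewrite !inE.
exists (restr w [fset u in v :: p1]%fset), (restr w F); split; try exact: restr_le.
- apply: (@disjoint_restr _ _ _ _ x) => u; rewrite memF mem1 [_ \in x :: _]inE => up.
  by case/orP=> [/eqP //|/p12]; rewrite up.
- exists p1; split=> //; last by move=> u /(allP p1S).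
  by apply: path_restr wp1 => u; rewrite mem1.
- exists (restr (restr w F) [fset x; y]%fset), (restr (restr w F) G).
  split; try exact: restr_le.
  + apply: (@disjoint_restr _ _ _ _ y) => u; rewrite memG in_fset2 => /orP[/eqP ->|/eqP ->//].
    by move/p12; rewrite xp1.
  + apply: restr_adj; rewrite ?inE ?eqxx ?orbT //.
    by apply: restr_adj xy; rewrite memF !inE eqxx ?orbT.
  + exists p2; split=> //; last first.
      by move=> u uy; apply: pX; rewrite mem_cat uy orbT.
    apply: path_restr => [u|]; first by rewrite memG.
    apply: (@path_restr w F y p2) wp2 => u; rewrite memF => uy.
    by rewrite inE uy orbT.
Qed.

End first_exit.

Section finite_volume_P.
Context {R : realType} {d : nat}.
Local Notation V := 'rV[int]_d.
Variables (P : probability (configuration d) R) (p : edge d -> R).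
Hypothesis P_open : forall e, P [set w | w e] = (p e)%:E.
Hypothesis P_indep :
  mutually_independent P (fun e : edge d => [set w : configuration d | w e]).
Implicit Types (X Y S : {fset V}) (x y z : V).

Lemma p01 e : 0 <= p e <= 1.
Proof.
rewrite -!lee_fin -P_open measure_ge0 /=; apply: probability_le1.
exact: measurable_open.
Qed.

Lemma P_pr X (A : set (configuration d)) : determined (inner_edges X) A ->
  P A = (pr p X A)%:E.
Proof. by apply: P_determined => //; exact: uniq_inner_edges. Qed.

Lemma inner_edges_sub S X : {subset S <= X} -> {subset inner_edges S <= inner_edges X}.
Proof.
move=> SX e; rewrite !mem_inner_edges => /fsubset_trans; apply.
exact/fsubsetP.
Qed.

(** Both sides are the measure of [A] under [P]. *)
Lemma pr_sub S X (A : set (configuration d)) : {subset S <= X} ->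
  determined (inner_edges S) A -> pr p S A = pr p X A.
Proof.
move=> SX dA; apply: EFin_inj; rewrite -!P_pr //.
exact: determined_sub (inner_edges_sub SX) dA.
Qed.

Lemma pr_open X (e : edge d) : e \in inner_edges X -> pr p X [set w | w e] = p e.
Proof.
move=> eX; apply: EFin_inj; rewrite -P_pr ?P_open //.
by move=> w w' ww' /=; rewrite ww'.
Qed.

Variable JB : V -> V -> R.
Hypothesis p_le : forall (e : edge d) x y, val e = [fset x; y]%fset -> p e <= JB x y.

Lemma pr_adj_le X x y : x \in X -> y \in X -> x != y -> pr p X (adj_ev x y) <= JB x y.
Proof.
move=> xX yX xy; have c2 : #|` [fset x; y]%fset| == 2%N by rewrite cardfs2 xy.
pose e : edge d := exist _ [fset x; y]%fset c2.
have -> : adj_ev x y = [set w | w e].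
  apply/seteqP; split=> w.
    by move=> /open_adjP[e' ve'] /=; rewrite (_ : e' = e) //; exact: val_inj.
  by move=> /= we; apply/open_adjP; exists e.
rewrite pr_open; first exact: p_le.
rewrite mem_inner_edges; apply/fsubsetP => u; rewrite in_fset2.
by case/orP=> /eqP ->.
Qed.

(** Union bound over the exit edge, followed by two applications of the van den Berg-Kesten
    inequality. *)
Lemma pr_conn_exit X S v z : v \in S -> z \notin S ->
  pr p X (conn_ev X v z) <= \sum_(x <- S) \sum_(y <- X | y \notin S)
    pr p S (conn_ev S v x) * (JB x y * pr p X (conn_ev X y z)).
Proof.
(* [S] may stick out of [X], so the disjoint occurrence is estimated in their union. *)
move=> vS zS; set U := (X `|` S)%fset.
have XU : {subset X <= U} by move=> u uX; rewrite inE uX.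
have SU : {subset S <= U} by move=> u uS; rewrite inE uS orbT.
have dX y := @conn_ev_determined _ X y z; have dS x := @conn_ev_determined _ S v x.
rewrite (pr_sub XU (dX v)).
apply: (@le_trans _ _ (\sum_(x <- S) \sum_(y <- X | y \notin S)
    pr p U (box (conn_ev S v x) (box (adj_ev x y) (conn_ev X y z))))).
  under eq_bigr do rewrite -Ex_sum; rewrite -Ex_sum.
  apply: le_Ex => [|w]; first exact: p01.
  have [c|nc] := pselect (conn_ev X v z w); last first.
    rewrite (ind_false nc); apply: sumr_ge0 => x _; apply: sumr_ge0 => y _.
    exact: ind_ge0.
  have [x xS [y /andP[yX yS] b]] := conn_first_exit vS zS c.
  rewrite (ind_true c) (big_fsetD1 x) //=; apply: ler_wpDr.
    by rewrite sumr_ge0 // => ? _; rewrite sumr_ge0 // => ? _; exact: ind_ge0.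
  rewrite (big_rem y) //= yS; apply: ler_wpDr.
    by rewrite sumr_ge0 // => ? _; exact: ind_ge0.
  by rewrite ind_true.
rewrite big_seq [leRHS]big_seq; apply: ler_sum => x xS.
rewrite big_seq_cond [leRHS]big_seq_cond; apply: ler_sum => y /andP[yX yS].
rewrite (pr_sub SU (dS x)) (pr_sub XU (dX y)).
have iX := @conn_ev_increasing _ X y z.
apply: le_trans (pr_bk p01 _ _ (@box_increasing _ _ _)) _; first exact: conn_ev_increasing.
apply: ler_wpM2l; first exact: (pr_ge0 p01).
apply: le_trans (pr_bk p01 _ (@adj_ev_increasing _ x y) iX) _.
apply: ler_wpM2r; first exact: (pr_ge0 p01).
apply: pr_adj_le; [exact: SU|exact: XU|].
by apply: contraNneq yS => <-.
Qed.

(* At a vertex [u] maximizing the expected cluster size [g], splitting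
   connections at their first exit from [S u] gives [g u <= c + phi * g u]. *)
Lemma expected_cl_bounded X (c phi : R) (S : V -> {fset V}) (h : V -> V -> R) :
  0 <= c -> phi < 1 ->
  (forall v, v \in X -> v \in S v) ->
  (forall v, v \in X -> (#|` S v|)%:R <= c) ->
  (forall v x, v \in X -> x \in S v -> \sum_(y <- X | y \notin S v) JB x y <= h v x) ->
  (forall v, v \in X -> \sum_(x <- S v) pr p (S v) (conn_ev (S v) v x) * h v x <= phi) ->
  forall v, v \in X -> \sum_(z <- X) pr p X (conn_ev X v z) <= c / (1 - phi).
Proof.
move=> c0 phi1 vS Sc Jh hphi v vX.
have JB0 x y : x != y -> 0 <= JB x y.
  move=> xy; have c2 : #|` [fset x; y]%fset| == 2%N by rewrite cardfs2 xy.
  pose e : edge d := exist _ [fset x; y]%fset c2.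
  by apply: (le_trans _ (@p_le e x y erefl)); have /andP[] := p01 e.
pose g v := \sum_(z <- X) pr p X (conn_ev X v z).
have g0 u : 0 <= g u by apply: sumr_ge0 => z _; exact: (pr_ge0 p01).
have [u uX gmax] : exists2 u, u \in X & forall v, v \in X -> g v <= g u.
  have [u _ umax] := @arg_maxP _ _ _ [` vX]%fset xpredT (fun u : X => g (val u)) isT.
  by exists (val u); [exact: valP|move=> v' v'X; exact: (umax [` v'X]%fset)].
apply: (le_trans (gmax v vX)); rewrite ler_pdivlMr ?subr_gt0 //.
rewrite mulrBr mulr1 lerBlDr -/(g u).
rewrite {1}/g (bigID (mem (S u))) /=; apply: lerD.
  apply: le_trans (Sc u uX).
  apply: (@le_trans _ _ (\sum_(z <- X | z \in S u) 1)).
    by apply: ler_sum => z _; exact: (pr_le1 p01).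
  rewrite -big_filter big_const_seq count_predT iter_addr_0 ler_nat.
  apply: uniq_leq_size; first exact: filter_uniq (fset_uniq _).
  by move=> z; rewrite mem_filter => /andP[].
apply: (@le_trans _ _ (\sum_(z <- X | z \notin S u)
    \sum_(x <- S u) \sum_(y <- X | y \notin S u)
    pr p (S u) (conn_ev (S u) u x) * (JB x y * pr p X (conn_ev X y z)))).
  by apply: ler_sum => z zS; apply: pr_conn_exit => //; exact: vS.
rewrite exchange_big /=.
apply: (@le_trans _ _ (\sum_(x <- S u) pr p (S u) (conn_ev (S u) u x) * h u x * g u)).
  rewrite big_seq [leRHS]big_seq; apply: ler_sum => x xS.
  rewrite exchange_big /=.
  apply: (@le_trans _ _ (\sum_(y <- X | y \notin S u)
      pr p (S u) (conn_ev (S u) u x) * (JB x y * g u))).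
    rewrite big_seq_cond [leRHS]big_seq_cond; apply: ler_sum => y /andP[yX yS].
    rewrite -mulr_sumr; apply: ler_wpM2l; first exact: (pr_ge0 p01).
    rewrite -mulr_sumr; apply: ler_wpM2l.
      by apply: JB0; apply: contraNneq yS => <-.
    apply: le_trans (gmax y yX); rewrite /g [leRHS](bigID (mem (S u))) /=.
    by apply: ler_wpDl => //; apply: sumr_ge0 => z _; exact: (pr_ge0 p01).
  rewrite -mulr_sumr -mulrA; apply: ler_wpM2l; first exact: (pr_ge0 p01).
  by rewrite -mulr_suml; apply: ler_wpM2r => //; exact: Jh.
by rewrite -mulr_suml mulrC; apply: ler_wpM2l => //; exact: hphi.
Qed.

End finite_volume_P.

(** * Translation invariance *)

Lemma Ex_map (R : realType) (K K' : eqType) (p : K' -> R) (f : K -> K') s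
    (F : (K' -> bool) -> R) (G : (K -> bool) -> R) w :
  injective f -> (forall w, F w = G (w \o f)) ->
  Ex p (map f s) F w = Ex (p \o f) s G (w \o f).
Proof.
move=> injf; elim: s F G => [|e s ih] F G FG //=.
have updf w' b : upd w' (f e) b \o f = upd (w' \o f) e b.
  by apply/funext => e'; rewrite /upd /= (inj_eq injf).
have step b : Ex p (map f s) (fun w => F (upd w (f e) b)) w
    = Ex (p \o f) s (fun w => G (upd w e b)) (w \o f).
  by apply: ih => w'; rewrite FG updf.
by rewrite !step.
Qed.

Section translation.
Context {d : nat}.
Local Notation V := 'rV[int]_d.
Implicit Types (w : configuration d) (X Y S : {fset V}) (x y z a : V).

Definition shift a X : {fset V} := [fset (x + a)%R | x in X]%fset.

Lemma mem_shift a X x : (x \in shift a X) = (x - a \in X).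
Proof.
apply/imfsetP/idP => [[y yX ->]|xX]; first by rewrite addrK.
by exists (x - a) => //; rewrite subrK.
Qed.

Lemma card_shift a X : #|` shift a X| = #|` X|.
Proof. by rewrite card_imfset //; exact: addIr. Qed.

Lemma shiftK a X : shift (- a) (shift a X) = X.
Proof. by apply/fsetP => x; rewrite !mem_shift opprK addrK. Qed.

Lemma sum_shift (R : realType) a X (F : V -> R) :
  \sum_(x <- shift a X) F x = \sum_(x <- X) F (x + a).
Proof. by rewrite big_imfset //= => x y _ _; exact: addIr. Qed.

Lemma shift2 a x y : shift a [fset x; y]%fset = [fset (x + a)%R; (y + a)%R]%fset.
Proof.
by apply/fsetP => z; rewrite mem_shift !in_fset2 !subr_eq.
Qed.

Lemma shift_edge_subproof a (e : edge d) : #|` shift a (val e)| == 2%N.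
Proof. by rewrite card_shift; exact: (proj2_sig e). Qed.

Definition shift_edge a (e : edge d) : edge d :=
  exist _ (shift a (val e)) (shift_edge_subproof a e).

Lemma shift_edgeK a : cancel (shift_edge a) (shift_edge (- a)).
Proof. by move=> e; apply/val_inj => /=; rewrite shiftK. Qed.

Lemma shift_edge_inj a : injective (shift_edge a). Proof. exact: can_inj (shift_edgeK a). Qed.

Definition shift_conf a w : configuration d := w \o shift_edge a.

Lemma shift_confK a w : shift_conf (- a) (shift_conf a w) = w.
Proof. by apply/funext => e; rewrite /shift_conf /= -{1}(opprK a) shift_edgeK. Qed.

Lemma open_adj_tr a w x y : open_adj (shift_conf a w) x y -> open_adj w (x + a) (y + a).
Proof.
by move=> /open_adjP[e ve we]; apply/open_adjP; exists (shift_edge a e); rewrite //= ve shift2.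
Qed.

Lemma conn_tr a w X x y : conn (open_adj (shift_conf a w)) X x y ->
  conn (open_adj w) (shift a X) (x + a) (y + a).
Proof.
move=> [p [wp <- pX]]; exists (map (+%R^~ a) p); split.
- rewrite (path_map (f := +%R^~ a)); apply: sub_path wp => u v; exact: open_adj_tr.
- by rewrite (last_map (fun z => z + a) p x).
- move=> z; rewrite mem_shift -(map_cons (+%R^~ a)) => /mapP[u up ->].
  by rewrite addrK; exact: pX.
Qed.

Lemma conn_ev_tr a X x y :
  conn_ev (shift a X) (x + a) (y + a) = shift_conf a @^-1` conn_ev X x y.
Proof.
apply/seteqP; split=> w; last exact: conn_tr.
rewrite /preimage /conn_ev /= -{1}(shift_confK a w) => /conn_tr.
by rewrite shiftK !addrK.
Qed.

Lemma cl_tr a w X x : cl (open_adj w) (shift a X) (x + a)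
  = shift a (cl (open_adj (shift_conf a w)) X x).
Proof.
apply/fsetP => y; rewrite mem_shift.
have := conn_ev_tr a X x (y - a); rewrite subrK => /seteqP[sub1 sub2].
by apply/mem_cl/mem_cl; [exact: sub1|exact: sub2].
Qed.

Lemma cl_ge_tr a X x k : cl_ge (shift a X) (x + a) k = shift_conf a @^-1` cl_ge X x k.
Proof. by apply/funext => w; rewrite /preimage /cl_ge /= cl_tr card_shift. Qed.

End translation.

Section translation_P.
Context {R : realType} {d : nat}.
Local Notation V := 'rV[int]_d.
Variables (P : probability (configuration d) R) (p : edge d -> R).
Hypothesis P_open : forall e, P [set w | w e] = (p e)%:E.
Hypothesis P_indep :
  mutually_independent P (fun e : edge d => [set w : configuration d | w e]).
Hypothesis p_tr : forall a e, p (shift_edge a e) = p e.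

(** The translates of the edges inside [X] and the edges inside the translate of [X] may be listed
    differently; both lists compute the measure of the event under [P], and the first is a
    relabelling that preserves edge probabilities. *)
Lemma pr_tr a (X : {fset V}) (A : set (configuration d)) :
  determined (inner_edges X) A ->
  determined (inner_edges (shift a X)) (shift_conf a @^-1` A) ->
  pr p (shift a X) (shift_conf a @^-1` A) = pr p X A.
Proof.
move=> dA dA'; apply: EFin_inj; rewrite -(P_pr P_open P_indep dA').
have uX : uniq (map (shift_edge a) (inner_edges X)).
  by rewrite (map_inj_uniq (@shift_edge_inj _ a)) uniq_inner_edges.
rewrite (P_determined P_open P_indep (fun=> false) uX); last first.
  move=> w w' ww'; apply: dA => e eX; rewrite /shift_conf /= ww' //.
  exact: map_f.
congr (_%:E).
rewrite (@Ex_map _ _ _ p (shift_edge a) _ _ (fun w => ind (A w)) _ (@shift_edge_inj _ a)) //.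
by rewrite (_ : p \o shift_edge a = p) //; apply/funext => e /=; exact: p_tr.
Qed.

Lemma pr_conn_tr a X x y :
  pr p (shift a X) (conn_ev (shift a X) (x + a) (y + a)) = pr p X (conn_ev X x y).
Proof.
by rewrite conn_ev_tr pr_tr // -?conn_ev_tr; exact: conn_ev_determined.
Qed.

Lemma pr_cl_ge_tr a X x k :
  pr p (shift a X) (cl_ge (shift a X) (x + a) k) = pr p X (cl_ge X x k).
Proof. by rewrite cl_ge_tr pr_tr // -?cl_ge_tr; exact: cl_ge_determined. Qed.

End translation_P.

(** * Infinite volume *)

Section boxes.
Context {d : nat}.
Local Notation V := 'rV[int]_d.
Implicit Types (w : configuration d) (X Y S : {fset V}) (x y z a : V).

Definition of_ords (lo : int) n (v : 'rV['I_n]_d) : V :=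
  map_mx (fun k : 'I_n => lo + k%:Z) v.

Lemma of_ords_inj lo n : injective (@of_ords lo n).
Proof.
move=> u v uv; apply/matrixP => i j; apply: val_inj; apply/eqP.
by have /matrixP/(_ i j)/eqP := uv; rewrite !mxE (inj_eq (addrI _)).
Qed.

(** The cube of side [n] with lowest corner [lo], encoded as an image of vectors of ordinals so that
    sums over it factor into coordinates. *)
Definition zbox (lo : int) n : {fset V} :=
  [fset of_ords lo v | v in {: 'rV['I_n]_d}]%fset.

Lemma mem_zbox lo n z : (z \in zbox lo n) = [forall i, lo <= z 0 i < lo + n%:Z].
Proof.
apply/imfsetP/forallP => [[v _ ->] i|zlo].
  by rewrite mxE lerDl ltrD2l ltz_nat ltn_ord.
have lt (i : 'I_d) : (`|(z ord0 i - lo)%R|%N < n)%N.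
  by have := zlo i; move: (z ord0 i) => u; lia.
exists (\row_i Ordinal (lt i)) => //.
apply/matrixP => i j; rewrite !mxE /= !ord1.
by have := zlo j; move: (z ord0 j) => u; lia.
Qed.

Lemma card_zbox lo n : #|` zbox lo n| = (n ^ d)%N.
Proof.
rewrite card_imfset /=; last exact: of_ords_inj.
by rewrite -cardE card_mx mul1n card_ord.
Qed.

Lemma sum_zbox (R : realType) lo n (F : V -> R) :
  \sum_(x <- zbox lo n) F x = \sum_(v : 'rV['I_n]_d) F (of_ords lo v).
Proof.
rewrite big_imfset /=; first by rewrite big_enum.
by move=> u v _ _; exact: of_ords_inj.
Qed.

Definition cbox n := zbox (- n%:Z) n.*2.+1.

Lemma mem_cbox n z : (z \in cbox n) = [forall i, `|z 0 i| <= n%:Z].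
Proof.
by rewrite mem_zbox; apply/forallP/forallP => H i; have := H i; lia.
Qed.

Lemma cbox_mono m n : (m <= n)%N -> {subset cbox m <= cbox n}.
Proof.
move=> mn z; rewrite !mem_cbox => /forallP H; apply/forallP => i.
by have := H i; lia.
Qed.

Definition znorm (x : V) : nat := (\max_(i < d) `|x ord0 i|)%N.

Lemma le_znorm x i : (`|x ord0 i| <= znorm x)%N.
Proof. exact: (leq_bigmax i). Qed.

Lemma sub_cbox (s : seq V) : exists n, {subset s <= cbox n}.
Proof.
exists (\max_(x <- s) znorm x)%N => x xs; rewrite mem_cbox.
apply/forallP => i; have := leq_trans (le_znorm x i) (@leq_bigmax_seq _ s xpredT znorm x xs isT).
by move: (x _ i) (\max_(x <- s) znorm x)%N => u m; lia.
Qed.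

Lemma card_le_II_fset (T : choiceType) (A : set T) n :
  (`I_n #<= A)%card <-> exists2 B : {fset T}, [set` B] `<=` A & (n <= #|` B|)%N.
Proof.
split; last first.
  move=> [B BA nB]; apply: card_le_trans (subset_card_le BA).
  have /card_eq_fsetP Bn : #|` B| = #|` B| by [].
  by rewrite (card_le_eqr Bn) card_le_II.
elim/choicePpointed: T => T in A *.
  rewrite emptyE card_le0 => /eqP n0; exists fset0 => [x //|].
  by case: n n0 => // n n0; have : `I_n.+1 0%N by []; rewrite n0.
move=> /ppcard_leP[f]; exists (fset_set [set f i | i in `I_n]).
  rewrite fset_setK//; last exact: finite_image.
rewrite fset_set_image// card_in_imfset//=.
  by rewrite fset_set_II card_imfset//= ?size_enum_ord//; exact: val_inj.
by move=> i j; rewrite !in_fset_set // => iI jI; exact: ('inj_f iI jI).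
Qed.

(** Finitely many vertices of the cluster, together with open paths leading to them, fit into some
    centred cube. *)
Lemma cluster_geE n : cluster_ge d n = \bigcup_k cl_ge (cbox k) 0 n.
Proof.
apply/seteqP; split=> w.
  rewrite /cluster_ge /= => /card_le_II_fset[B Bcl nB].
  have /choice[p hp] : forall x, exists p, x \in B ->
      path (open_adj w) 0 p /\ last 0 p = x.
    move=> x; have [xB|] := boolP (x \in B); last by exists [::].
    by have [p hp] := Bcl x xB; exists p.
  have [k hk] := sub_cbox (0 :: flatten [seq p x | x <- B]).
  exists k => //; apply: (leq_trans nB); apply/fsubset_leq_card/fsubsetP => x xB.
  have [hp1 hp2] := hp x xB; apply/mem_cl; exists (p x); split=> // y.
  rewrite inE => /orP[/eqP ->|yp]; apply: hk; first exact: mem_head.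
  by rewrite inE; apply/orP; right; apply/flattenP; exists (p x) => //; exact: map_f.
move=> [k _ nk]; apply/card_le_II_fset; exists (cl (open_adj w) (cbox k) 0) => //.
by move=> x /= /mem_cl[p [wp lp _]]; exists p.
Qed.

Lemma infinite_clusterE :
  [set w : configuration d | infinite_set (cluster0 w)] = \bigcap_n cluster_ge d n.
Proof.
apply/seteqP; split=> w /=.
  by move=> /infinite_set_fsetP H n _; exact/card_le_II_fset.
by move=> H; apply/infinite_set_fsetP => n; exact/card_le_II_fset/H.
Qed.

End boxes.

(** * Criteria for the absence of percolation *)

Section no_percolation.
Context {R : realType} {d : nat}.
Local Notation V := 'rV[int]_d.
Variables (P : probability (configuration d) R) (p : edge d -> R).
Hypothesis P_open : forall e, P [set w | w e] = (p e)%:E.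
Hypothesis P_indep :
  mutually_independent P (fun e : edge d => [set w : configuration d | w e]).
Hypothesis p_tr : forall a e, p (shift_edge a e) = p e.

Let p01 := p01 P_open.

Lemma measurable_cluster_ge n : measurable (cluster_ge d n).
Proof.
rewrite cluster_geE; apply: bigcup_measurable => k _.
exact: determined_measurable (@cl_ge_determined _ _ _ _).
Qed.

(** Translate [x] to the origin, then enlarge the region to a centred cube. *)
Lemma pr_cl_ge_le X x n : ((pr p X (cl_ge X x n))%:E <= P (cluster_ge d n))%E.
Proof.
rewrite -(pr_cl_ge_tr P_open P_indep p_tr (- x)) subrr.
rewrite -(P_pr P_open P_indep); last exact: cl_ge_determined.
apply: le_measure; rewrite ?inE.
- exact: determined_measurable (@cl_ge_determined _ _ _ _).
- exact: measurable_cluster_ge.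
rewrite cluster_geE => w wn; have [k hk] := sub_cbox (shift (- x) X).
by exists k => //; apply: (leq_trans wn); apply: cl_mono.
Qed.

Lemma pr_cl_ge_markov X x n :
  n%:R * pr p X (cl_ge X x n) <= \sum_(z <- X) pr p X (conn_ev X x z).
Proof.
rewrite -Ex_sum -ExZ; apply: (le_Ex p01) => w; rewrite -cl_size_ind.
have [wn|nw] := pselect (cl_ge X x n w); last by rewrite (ind_false nw) mulr0.
by rewrite (ind_true wn) mulr1 ler_nat.
Qed.

(** Markov's inequality in each cube and a monotone limit bound the probability of [n + 1] vertices
    by [c / (n + 1)], and [n] is arbitrary. *)
Lemma no_percolation (c : R) :
  (forall k, \sum_(z <- cbox k) pr p (cbox k) (conn_ev (cbox k) 0 z) <= c) ->
  P [set w | infinite_set (cluster0 w)] = 0%E.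
Proof.
move=> hc.
have mcl k n : measurable (cl_ge (@cbox d k) 0 n).
  exact: determined_measurable (@cl_ge_determined _ _ _ _).
have Pn n : (P (cluster_ge d n.+1) <= (c / n.+1%:R)%:E)%E.
  have ndF : nondecreasing_seq (fun k => cl_ge (@cbox d k) 0 n.+1).
    move=> i j ij; apply/subsetPset => w /= /leq_trans; apply.
    by apply: cl_mono => //; exact: cbox_mono.
  have := nondecreasing_cvg_mu (mu := P) (fun k => mcl k n.+1) _ ndF.
  rewrite -cluster_geE => /(_ (measurable_cluster_ge _)) cvgP.
  rewrite -(cvg_lim _ cvgP) //; apply: lime_le; first by apply/cvg_ex; eexists; exact: cvgP.
  apply: nearW => k /=; rewrite (P_pr P_open P_indep (@cl_ge_determined _ (cbox k) 0 n.+1)).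
  by rewrite lee_fin ler_pdivlMr ?ltr0n// mulrC (le_trans (pr_cl_ge_markov _ _ _)).
have minf : measurable [set w : configuration d | infinite_set (cluster0 w)].
  rewrite infinite_clusterE; apply: bigcap_measurable => // n _.
  exact: measurable_cluster_ge.
have Pinf n : (P [set w | infinite_set (cluster0 w)] <= (c / n.+1%:R)%:E)%E.
  apply: le_trans (Pn n); apply: le_measure; rewrite ?inE //.
    exact: measurable_cluster_ge.
  by rewrite infinite_clusterE => w; exact.
apply/eqP; rewrite eq_le measure_ge0 andbT.
have c0 : 0 <= c by apply: le_trans (hc 0%N); apply: sumr_ge0 => z _; exact: (pr_ge0 p01).
apply/lee_addgt0Pr => e e0; rewrite add0e.
apply: le_trans (Pinf (Num.truncn (c / e))) _.
rewrite lee_fin ler_pdivrMr ?ltr0n// mulrC -ler_pdivrMr //.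
by rewrite ltW // truncnS_gt.
Qed.

Variable JB : V -> V -> R.
Hypothesis p_le : forall (e : edge d) x y, val e = [fset x; y]%fset -> p e <= JB x y.
Hypothesis JB_tr : forall a x y, JB (x + a) (y + a) = JB x y.

(** Each vertex [u] of a cube gets the translate of [S] that sends [v] to [u]; the resulting bound
    on the expected cluster size does not depend on the cube. The function [h] bounds the infinite
    sum of [JB x y] over [y] outside [S], expressed through finite sets. *)
Lemma no_percolation_of_phi (S : {fset V}) v (h : V -> R) : v \in S ->
  (forall x (Y : {fset V}), x \in S -> {in Y, forall y, y \notin S} ->
     \sum_(y <- Y) JB x y <= h x) ->
  \sum_(x <- S) pr p S (conn_ev S v x) * h x < 1 ->
  P [set w | infinite_set (cluster0 w)] = 0%E.
Proof.
move=> vS hh phi1.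
set phi := (X in X < 1) in phi1.
apply: (@no_percolation ((#|` S|)%:R / (1 - phi))) => k.
apply: (@expected_cl_bounded _ _ P p P_open P_indep JB p_le (cbox k) _ phi
  (fun u => shift (u - v) S) (fun u x => h (x - (u - v)))) => //.
- by move=> u _; rewrite mem_shift opprB addrC subrK.
- by move=> u _; rewrite card_shift.
- move=> u x _; rewrite mem_shift => xS.
  set Y := [fset y in cbox k | y \notin shift (u - v) S]%fset.
  have := hh _ (shift (- (u - v)) Y) xS _; rewrite sum_shift.
  rewrite (eq_bigr (fun y => JB x y)); last by move=> y _; exact: JB_tr.
  rewrite (_ : \sum_(y <- Y) JB x y = \sum_(y <- cbox k | y \notin shift (u - v) S) JB x y).
    apply => y; rewrite mem_shift opprK !inE => /andP[_].
    by rewrite mem_shift addrK.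
  by rewrite /Y [RHS]big_fset_condE.
- move=> u _; rewrite sum_shift le_eqVlt; apply/orP; left; apply/eqP.
  apply: eq_bigr => x _; rewrite addrK; congr (_ * _).
  rewrite -[in RHS](pr_conn_tr P_open P_indep p_tr (u - v)); congr (pr _ _ (conn_ev _ _ _)).
  by rewrite addrC subrK.
- rewrite mem_cbox; apply/forallP => i; rewrite mxE normr0.
  by [].
Qed.

End no_percolation.

(** * The Duminil-Copin--Tassion quantity at the critical point *)

Section criticality.
Context {R : realType} {d : nat}.
Local Notation V := 'rV[int]_d.
Variables (J : V -> V -> R).
Hypothesis J_sym : symmetric_kernel J.
Hypothesis J_trans : translation_invariant J.

(** The ends of an unordered edge are ordered by choice; by symmetry of [J] the value does not
    depend on it, see [edge_kernelE]. *)
Definition edge_kernel (e : edge d) : R :=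
  let: exist x h := cid (edgeP e) in let: exist y _ := cid h in J x y.

Lemma edge_kernelE (e : edge d) x y : val e = [fset x; y]%fset -> edge_kernel e = J x y.
Proof.
move=> ve; rewrite /edge_kernel; case: cid => x' h; case: cid => y' [xy'].
rewrite ve => /fsetP E.
have := E x'; have := E y'; rewrite !in_fset2 !eqxx orbT /= => {E}.
by move=> /orP[]/eqP yE /orP[]/eqP xE; move: xy'; rewrite xE yE ?eqxx //; rewrite J_sym.
Qed.

Definition edge_prob (beta : R) (e : edge d) : R := 1 - expR (- (beta * edge_kernel e)).

Lemma edge_prob_tr beta a e : edge_prob beta (shift_edge a e) = edge_prob beta e.
Proof.
have [x [y [_ ve]]] := edgeP e.
rewrite /edge_prob (edge_kernelE ve) (@edge_kernelE _ (x + a) (y + a)); last first.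
  by rewrite /= ve shift2.
by rewrite J_trans [in RHS]J_trans opprD addrACA subrr addr0.
Qed.

Lemma edge_prob_le beta (e : edge d) x y :
  val e = [fset x; y]%fset -> edge_prob beta e <= beta * J x y.
Proof.
move=> ve; rewrite /edge_prob (edge_kernelE ve).
by have := expR_ge1Dx (- (beta * J x y)); lra.
Qed.

Lemma Ex_edge_prob_continuous s F w :
  continuous (fun beta : R => Ex (edge_prob beta) s F w).
Proof.
elim: s F => [|e s ih] F beta /=; first exact: cvg_cst.
have cp : {for beta, continuous (fun beta => edge_prob beta e)}.
  apply: cvgB; first exact: cvg_cst.
  apply: continuous_comp; last exact: continuous_expR.
  by apply: cvgN; apply: cvgM; [exact: cvg_id|exact: cvg_cst].
apply: cvgD; apply: cvgM; [exact: cp|exact: ih| |exact: ih].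
by apply: cvgB; [exact: cvg_cst|exact: cp].
Qed.

Variable P : R -> probability (configuration d) R.
Hypothesis P_perc : forall beta : R, 0 <= beta -> is_percolation_measure J beta (P beta).

Lemma P_open beta : 0 <= beta -> forall e, P beta [set w | w e] = (edge_prob beta e)%:E.
Proof.
move=> /P_perc[H _] e; have [x [y [_ ve]]] := edgeP e.
by rewrite (H _ _ _ ve) /edge_prob (edge_kernelE ve).
Qed.

Lemma P_indep beta : 0 <= beta ->
  mutually_independent (P beta) (fun e : edge d => [set w : configuration d | w e]).
Proof. by move=> /P_perc[]. Qed.

Hypothesis beta_c_fin : (beta_c P < +oo)%E.

Lemma beta_c_ge0 : (0 <= beta_c P)%E.
Proof. by apply: le_ereal_inf_tmp => _ [beta [b0 _] <-]; rewrite lee_fin. Qed.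

Lemma beta_cE : beta_c P = (fine (beta_c P))%:E.
Proof. by rewrite fineK // ge0_fin_numE // beta_c_ge0. Qed.

(** If [phi] were below 1 at the critical point, continuity would keep it below 1 slightly above,
    where there would be no percolation. *)
Lemma critical_phi_ge1 (S : {fset V}) v (h : V -> R) : v \in S ->
  (forall x (Y : {fset V}), x \in S -> {in Y, forall y, y \notin S} ->
     \sum_(y <- Y) J x y <= h x) ->
  1 <= fine (beta_c P) *
    \sum_(x <- S) pr (edge_prob (fine (beta_c P))) S (conn_ev S v x) * h x.
Proof.
move=> vS hh; set bc := fine (beta_c P); rewrite leNgt; apply/negP => phi1.
pose phi (beta : R) := beta * \sum_(x <- S) pr (edge_prob beta) S (conn_ev S v x) * h x.
have phic : {for bc, continuous phi}.
  have -> : phi = fun beta => beta * Ex (edge_prob beta) (inner_edges S)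
      (fun w => \sum_(x <- S) h x * ind (conn_ev S v x w)) (fun=> false).
    apply/funext => beta; rewrite Ex_sum /phi; congr (_ * _).
    by apply: eq_bigr => x _; rewrite ExZ mulrC.
  by apply: cvgM; [exact: cvg_id|exact: Ex_edge_prob_continuous].
have : \forall b \near bc, phi b < 1.
  exact: (cvgr_lt (phi bc) phic 1 phi1).
move=> /nbhs_ballP[e /= e0 he].
(* A percolating [beta] is at least [bc], and none lies in [[bc, bc + e)], so the infimum would be
   too large. *)
suff : (beta_c P >= (bc + e)%:E)%E.
  by rewrite beta_cE -/bc lee_fin gerDl leNgt e0.
apply: le_ereal_inf_tmp => _ [beta [b0 perc] <-]; rewrite lee_fin leNgt; apply/negP => be.
have bcb : bc <= beta.
  rewrite -lee_fin -beta_cE; apply: ereal_inf_lbound.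
  by exists beta.
have phib : phi beta < 1.
  by apply: he; rewrite /ball /= distrC ger0_norm ?subr_ge0 // ltrBlDl.
suff P0 : P beta [set w | infinite_set (cluster0 w)] = 0%E by rewrite P0 ltxx in perc.
apply: (@no_percolation_of_phi _ _ _ _ (P_open b0) (P_indep b0) (edge_prob_tr beta)
  (fun x y => beta * J x y) (@edge_prob_le beta) _ S v (fun x => beta * h x)) => //.
- by move=> a x y; rewrite J_trans [in RHS]J_trans opprD addrACA subrr addr0.
- by move=> x Y xS YS; rewrite -mulr_sumr; apply: ler_wpM2l => //; exact: hh.
- move: phib; rewrite /phi mulr_sumr; congr (_ < _).
  by apply: eq_bigr => x _; rewrite mulrCA.
Qed.

End criticality.

(** * Summability estimates *)

Section analysis.
Context {R : realType}.

(** The right side is the integral of [y ^ (-1 - eta)] over [[x, x + 1]]. The proof uses only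
    [ln (1 + u) <= u] and [1 + u <= exp u]. *)
Lemma powR_diff_ge (eta x : R) : 0 < eta -> 0 < x ->
  (x + 1) `^ (- 1 - eta) <= eta^-1 * (x `^ (- eta) - (x + 1) `^ (- eta)).
Proof.
move=> eta0 x0; have x1 : 0 < x + 1 by rewrite addr_gt0.
set u := (x + 1) `^ (- eta).
have -> : (x + 1) `^ (- 1 - eta) = u / (x + 1).
  rewrite (addrC (- 1)) powRD; last by rewrite (gt_eqF x1) implybT.
  by rewrite powR_inv1 // ltW.
rewrite ler_pdivlMl //.
have u0 : 0 < u by exact: powR_gt0.
have ux : x `^ (- eta) = u * expR (- eta * (ln x - ln (x + 1))).
  rewrite /u /powR !gt_eqF // -expRD; congr expR; ring.
have lnle : ln x - ln (x + 1) <= - (x + 1)^-1.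
  rewrite -ln_div ?posrE //.
  have -> : x / (x + 1) = 1 + - (x + 1)^-1 by field; rewrite gt_eqF.
  apply: le_ln1Dx; rewrite ltrN2 invf_lt1 //; lra.
have := expR_ge1Dx (- eta * (ln x - ln (x + 1))).
have : eta / (x + 1) <= - eta * (ln x - ln (x + 1)).
  by rewrite mulNr -mulrN ler_pM2l // lerNr.
rewrite ux => h1 h2; apply: (@le_trans _ _ (u * (eta / (x + 1)))).
  by rewrite le_eqVlt; apply/orP; left; apply/eqP; ring.
rewrite -[X in _ - X]mulr1 -mulrBr ler_pM2l //.
by rewrite lerBrDl (le_trans _ h2) // lerD2l.
Qed.

Lemma zeta_le (eta : R) n : 0 < eta ->
  \sum_(k < n) (k.+1%:R : R) `^ (- 1 - eta) <= 1 + eta^-1.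
Proof.
move=> eta0; have e0 : 0 <= eta^-1 by rewrite invr_ge0 ltW.
(* The telescoping remainder is kept so that the induction closes. *)
suff H m : \sum_(k < m.+1) (k.+1%:R : R) `^ (- 1 - eta)
    <= 1 + eta^-1 - eta^-1 * m.+1%:R `^ (- eta).
  case: n => [|n]; first by rewrite big_ord0 addr_ge0.
  by apply: le_trans (H n) _; rewrite gerBl mulr_ge0 // powR_ge0.
elim: m => [|m ih].
  by rewrite big_ord1 !powR1 mulr1 addrK.
rewrite big_ord_recr /=.
have := @powR_diff_ge eta m.+1%:R eta0; rewrite ltr0n => /(_ isT).
by rewrite natr1 mulrBr; lra.
Qed.

Lemma row_norm_ge d (v : 'rV[R]_d) i : `|v ord0 i| <= `|v|.
Proof.
by rewrite [leRHS]/Num.Def.normr /= mx_normrE; apply/bigmax_geP; right => /=; exists (ord0, i).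
Qed.

(** [N] is continuous and so attains a minimum, which is positive, on the unit sphere of the sup
    norm; homogeneity does the rest. *)
Lemma is_norm_lower_bound d (N : 'rV[R]_d -> R) : is_norm N ->
  exists2 c : R, 0 < c & forall v, c * `|v| <= N v.
Proof.
move=> [N0 Neq NZ ND].
pose C := \sum_(i < d) N (delta_mx 0 i).
have C0 : 0 <= C by apply: sumr_ge0.
have N00 : N 0 = 0 by rewrite -(scale0r 0) NZ normr0 mul0r.
have NC v : N v <= C * `|v|.
  rewrite {1}(row_sum_delta v) mulr_suml.
  apply: (@le_trans _ _ (\sum_i N (v 0 i *: delta_mx 0 i))).
    elim/big_ind2 : _ => [|x x' y y' hx hy|//]; first by rewrite N00.
    exact: le_trans (ND _ _) (lerD hx hy).
  apply: ler_sum => i _; rewrite NZ mulrC; apply: ler_wpM2l => //.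
  exact: row_norm_ge.
have Ncont : continuous N.
  move=> v A /nbhs_ballP[e /= e0 eA].
  have C1 : 0 < C + 1 by lra.
  have : nbhs v (ball v (e / (C + 1))) by apply: nbhsx_ballx; rewrite divr_gt0.
  apply: (@filterS _ _ (nbhs_filter v)) => u; rewrite mx_norm_ball /ball_ /= => uv.
  have key a b : N a - N b <= C * `|a - b|.
    by rewrite lerBlDr; apply: le_trans (lerD (NC _) (lexx _)); rewrite -{1}(subrK b a) ND.
  apply: eA; rewrite /ball /=.
  apply: (@le_lt_trans _ _ (C * `|v - u|)).
    by rewrite ler_norml key lerNl opprB distrC key.
  apply: (@le_lt_trans _ _ ((C + 1) * `|v - u|)).
    by apply: ler_wpM2r => //; lra.
  by rewrite mulrC -ltr_pdivlMr.
pose S := [set v : 'rV[R]_d | `|v| = 1].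
(* If the sphere is empty, every vector is zero and the constant 1 serves. *)
have [S0|S0] := pselect (S !=set0); last first.
  exists 1 => // v; have [->|v0] := eqVneq v 0; first by rewrite normr0 mulr0.
  exfalso; apply: S0; exists (`|v|^-1 *: v).
  by rewrite /S /= normrZ normfV normr_id mulVf // normr_eq0.
have Sc : compact S.
  apply: bounded_closed_compact.
    exists 1; split; first exact: num_real.
    by move=> x x1 v /= ->; exact: ltW.
  rewrite (_ : S = (fun v : 'rV[R]_d => `|v|) @^-1` [set 1]) //.
  apply: closed_comp; last exact: closed_eq.
  by move=> v _; exact: norm_continuous.
have [u uS umin] := EVT_min_rV S0 Sc (continuous_subspaceT Ncont).
rewrite inE /S /= in uS.
exists (N u).
  rewrite lt_neqAle N0 andbT eq_sym; apply/negP => /eqP/Neq u0.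
  by move: uS; rewrite u0 normr0 => /eqP; rewrite eq_sym oner_eq0.
move=> v; have [->|v0] := eqVneq v 0; first by rewrite normr0 mulr0.
have nv : 0 < `|v| by rewrite normr_gt0.
have := umin (`|v|^-1 *: v); rewrite NZ ger0_norm ?invr_ge0 // ler_pdivlMl // mulrC.
by apply; rewrite inE /S /= normrZ normfV normr_id mulVf // gt_eqF.
Qed.

Lemma znorm_le_norm d (z : 'rV[int]_d) : (znorm z)%:R <= `|toR R z|.
Proof.
rewrite /znorm; elim/big_ind: _ => [|m n hm hn|i _]; first exact: normr_ge0.
  by rewrite /maxn; case: ifP.
by apply: le_trans (row_norm_ge _ i); rewrite mxE -intr_norm natr_absz.
Qed.

End analysis.

(** * Moments of the kernel and its flux out of a cube *)

Section kernel_sums.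
Context {R : realType} {d : nat}.
Local Notation V := 'rV[int]_d.

(** Split [k ^ (-s)] as [k ^ (1 - s')] times [k ^ (-1 - (s - s'))]: the first factor is at most
    [n ^ (1 - s')], the second is summable. Giving up [s - s'] treats [s] below, at and above 1
    alike. *)
Lemma sum_powR_le (s s' : R) n : s' < s -> s' <= 1 ->
  \sum_(k < n) (k.+1%:R : R) `^ (- s) <= n%:R `^ (1 - s') * (1 + (s - s')^-1).
Proof.
move=> ss' s'1; have e0 : 0 < s - s' by rewrite subr_gt0.
apply: le_trans (ler_wpM2l (powR_ge0 _ _) (zeta_le n e0)).
rewrite mulr_sumr; apply: ler_sum => k _.
have -> : - s = (1 - s') + (- 1 - (s - s')) by ring.
rewrite powRD; last by rewrite pnatr_eq0 implybT.
apply: ler_wpM2r; first exact: powR_ge0.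
by apply: ge0_ler_powR; rewrite ?nnegrE ?subr_ge0 ?ler_nat.
Qed.

Lemma sum_zbox_prod lo n (F : 'I_d -> int -> R) :
  \sum_(x <- zbox lo n) \prod_i F i (x ord0 i) = \prod_i \sum_(k < n) F i (lo + k%:Z).
Proof.
rewrite sum_zbox bigA_distr_bigA /=.
rewrite (reindex (fun f : {ffun 'I_d -> 'I_n} => \row_i f i)) /=.
  by apply: eq_bigr => f _; apply: eq_bigr => i _; rewrite !mxE.
exists (fun v : 'rV['I_n]_d => [ffun i => v ord0 i]) => [f _|v _].
  by apply/ffunP => i; rewrite ffunE mxE.
by apply/rowP => i; rewrite mxE ffunE.
Qed.

Lemma sum_zbox_coord lo n (u : int -> R) (i : 'I_d) :
  \sum_(x <- zbox lo n) u (x ord0 i) = n%:R ^+ d.-1 * \sum_(k < n) u (lo + k%:Z).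
Proof.
pose F (j : 'I_d) k := if j == i then u k else 1.
have := sum_zbox_prod lo n F.
rewrite (bigD1 i) //= [X in _ = X * _](eq_bigr (fun k : 'I_n => u (lo + k%:Z))); last first.
  by move=> k _; rewrite /F eqxx.
rewrite [X in _ = _ * X](eq_bigr (fun=> n%:R)); last first.
  move=> j ji; rewrite (eq_bigr (fun=> 1)) ?sumr_const ?card_ord // => k _.
  by rewrite /F (negbTE ji).
rewrite prodr_const cardC1 card_ord mulrC => <-.
apply: eq_bigr => x _; rewrite (bigD1 i) //= /F eqxx big1 ?mulr1 // => j ji.
by rewrite (negbTE ji).
Qed.

(** The maximum with 1 gives a zero coordinate the factor 1. *)
Let g (eta : R) (k : int) : R := (maxn 1 `|k|)%:R `^ (- 1 - eta).

Let sum_g_le eta n : 0 < eta ->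
  \sum_(k < n.*2.+1) g eta (- n%:Z + k%:Z) <= 1 + (1 + eta^-1) *+ 2.
Proof.
move=> eta0; have -> : \sum_(k < n.*2.+1) g eta (- n%:Z + k%:Z)
    = 1 + (\sum_(k < n) (k.+1%:R : R) `^ (- 1 - eta)) *+ 2.
  elim: n => [|n ih]; first by rewrite !(big_ord1, big_ord0) /g !powR1 mul0rn addr0.
  rewrite doubleS big_ord_recr big_ord_recl /=.
  rewrite (eq_bigr (fun k : 'I_(n.*2.+1) => g eta (- n%:Z + k%:Z))); last first.
    by move=> k _; congr g; rewrite /bump /=; lia.
  rewrite ih big_ord_recr /= /g.
  have -> : maxn 1 `|(- n.+1%:Z + 0%:Z)%R| = n.+1 by lia.
  have -> : maxn 1 `|(- n.+1%:Z + (n.*2.+2)%:Z)%R| = n.+1 by lia.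
  by rewrite mulrnDl mulr2n; ring.
by rewrite lerD2l lerMn2r zeta_le.
Qed.

(** Write the summand as a product of [d] equal factors, one per coordinate, and in each replace the
    sup norm by the smaller quantity [max(1, |z_i|)]. The sum over a cube then factors into
    one-dimensional sums. *)
Lemma sum_znorm_powR_le (eta : R) (Z : {fset V}) : (0 < d)%N -> 0 < eta -> 0 \notin Z ->
  \sum_(z <- Z) (znorm z)%:R `^ (- d%:R - eta)
    <= (1 + (1 + (eta / d%:R)^-1) *+ 2) ^+ d.
Proof.
move=> d0 eta0 Z0; have [n Zn] := sub_cbox Z.
have dR : 0 < d%:R :> R by rewrite ltr0n.
pose e := eta / d%:R; have e0 : 0 < e by rewrite divr_gt0.
apply: (@le_trans _ _ (\sum_(z <- cbox n) \prod_(i < d) g e (z ord0 i))); last first.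
  rewrite /cbox (sum_zbox_prod _ _ (fun=> g e)) prodr_const card_ord.
  rewrite lerXn2r ?nnegrE ?sum_g_le ?sumr_ge0 // => *; rewrite ?powR_ge0 //.
  by rewrite ?addr_ge0 ?mulrn_wge0 ?addr_ge0 ?invr_ge0 // ltW.
rewrite [leRHS](big_fsetID _ (mem Z)) /=; apply: ler_wpDr.
  by apply: sumr_ge0 => z _; apply: prodr_ge0 => i _; exact: powR_ge0.
have -> : [fset z in cbox n | z \in Z]%fset = Z.
  by apply/fsetP => z; rewrite !inE andb_idl // => /Zn.
rewrite big_seq [leRHS]big_seq; apply: ler_sum => z zZ.
have [i zi] : exists i, z ord0 i != 0.
  apply/existsP; apply: contraNT Z0 => /existsPn z0.
  rewrite (_ : 0 = z) //; apply/rowP => i; rewrite mxE.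
  by have := z0 i; rewrite negbK => /eqP.
have z1 : (0 < znorm z)%N by apply: leq_trans (le_znorm z i); rewrite absz_gt0.
have -> : - d%:R - eta = (- 1 - e) * d%:R.
  by rewrite /e mulrBl mulN1r divfK // gt_eqF.
rewrite powRrM powR_mulrn ?powR_ge0 // -[X in _ ^+ X]card_ord -prodr_const.
apply: ler_prod => j _; rewrite powR_ge0 /= /g.
have -> : - 1 - e = - (1 + e) by ring.
rewrite !powRN lef_pV2 ?posrE ?powR_gt0 ?ltr0n ?leq_max //.
apply: ge0_ler_powR; rewrite ?nnegrE ?ler0n ?ler_nat //; first by rewrite addr_ge0 // ltW.
by rewrite geq_max z1 le_znorm.
Qed.

Variables (J : V -> V -> R) (N : 'rV[R]_d -> R) (alpha : R).
Hypothesis d_gt0 : (0 < d)%N.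
Hypothesis N_norm : is_norm N.
Hypothesis alpha_gt0 : 0 < alpha.
Hypothesis J_ge0 : forall x y, 0 <= J x y.
Hypothesis J_trans : translation_invariant J.
Hypothesis J_decay : exists C1 : R, forall x y : V, x != y ->
  J x y <= C1 * N (toR R x - toR R y) `^ (- d%:R - alpha).

(** Comparing [N] with the sup norm, the summand is at most a constant times the power
    [-d - (alpha - s)] of the sup norm, which is summable. *)
Lemma kernel_moment s : s < alpha -> exists2 H : R, 0 <= H &
  forall Z : {fset V}, 0 \notin Z -> \sum_(z <- Z) J 0 z * (znorm z)%:R `^ s <= H.
Proof.
move=> sa; have [C1 hC1] := J_decay; have [c c0 hc] := is_norm_lower_bound N_norm.
have eta0 : 0 < alpha - s by rewrite subr_gt0.
set K := (1 + (1 + ((alpha - s) / d%:R)^-1) *+ 2) ^+ d.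
have K0 : 0 <= K.
  by rewrite exprn_ge0 // addr_ge0 ?mulrn_wge0 ?addr_ge0 ?invr_ge0 ?divr_ge0 // ltW.
set C := `|C1| * c `^ (- d%:R - alpha).
have C0 : 0 <= C by rewrite mulr_ge0 ?powR_ge0.
exists (C * K) => [|Z Z0]; first exact: mulr_ge0.
apply: le_trans (ler_wpM2l C0 (sum_znorm_powR_le d_gt0 eta0 Z0)).
rewrite mulr_sumr big_seq [leRHS]big_seq; apply: ler_sum => z zZ.
have z0 : 0 != z by apply: contraNneq Z0 => ->.
have z1 : (0 < znorm z)%N.
  rewrite lt0n; apply: contra z0 => /eqP zn; rewrite eq_sym; apply/eqP/rowP => i.
  by rewrite mxE; apply/eqP; rewrite -absz_eq0 -leqn0; have := le_znorm z i; rewrite zn.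
have r0 : 0 < (znorm z)%:R :> R by rewrite ltr0n.
have -> : - d%:R - (alpha - s) = (- d%:R - alpha) + s by ring.
rewrite powRD; last by apply/implyP => _; rewrite gt_eqF.
rewrite mulrA; apply: ler_wpM2r; first exact: powR_ge0.
apply: (le_trans (hC1 _ _ z0)).
apply: (@le_trans _ _ (`|C1| * N (toR R 0 - toR R z) `^ (- d%:R - alpha))).
  by apply: ler_wpM2r; [exact: powR_ge0|exact: ler_norm].
rewrite /C -mulrA; apply: ler_wpM2l => //.
rewrite -powRM ?(ltW c0) ?(ltW r0) //.
have cr : c * (znorm z)%:R <= N (toR R 0 - toR R z).
  apply: le_trans (hc _); apply: ler_wpM2l; first exact: ltW.
  have -> : toR R 0 - toR R z = - toR R z :> 'rV[R]_d.
    by apply/rowP => i; rewrite !mxE sub0r.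
  by rewrite normrN znorm_le_norm.
have -> : - d%:R - alpha = - (d%:R + alpha) by ring.
have crp : 0 < c * (znorm z)%:R by rewrite mulr_gt0.
rewrite !powRN lef_pV2 ?posrE ?powR_gt0 //; last exact: lt_le_trans cr.
apply: ge0_ler_powR; rewrite ?nnegrE ?addr_ge0 ?(ltW crp) ?(ltW alpha_gt0) //.
exact: le_trans (ltW crp) cr.
Qed.

(* A step leaving the cube from [x] has sup-length at least the distance from [x]
   to the outside in some coordinate direction. *)
Definition box_flux (s : R) n (x : V) : R :=
  \sum_(i < d) ((`|x ord0 i|%N.+1)%:R `^ (- s) + (n - `|x ord0 i|%N)%:R `^ (- s)).

(** If every step out of the cube has length at least [m], the factor [(|y - x| / m) ^ s >= 1] may
    be inserted, which turns the sum into a moment of the kernel. *)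
Lemma box_flux_bound s H n (x : V) (Y : {fset V}) : 0 < s ->
  (forall Z : {fset V}, 0 \notin Z -> \sum_(z <- Z) J 0 z * (znorm z)%:R `^ s <= H) ->
  x \in zbox 0 n -> {in Y, forall y, y \notin zbox 0 n} ->
  \sum_(y <- Y) J x y <= H * box_flux s n x.
Proof.
move=> s0 hH xB YB.
have u0 (m : nat) : 0 <= m%:R `^ (- s) :> R by exact: powR_ge0.
have flux0 : 0 <= box_flux s n x by apply: sumr_ge0 => i _; exact: addr_ge0.
have Z0 : 0 \notin shift (- x) Y.
  by rewrite mem_shift sub0r opprK; apply/negP => /YB; rewrite xB.
apply: le_trans (ler_wpM2r flux0 (hH _ Z0)).
rewrite sum_shift mulr_suml big_seq [leRHS]big_seq; apply: ler_sum => y yY.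
rewrite J_trans -mulrA -[leLHS]mulr1; apply: ler_wpM2l => //.
set r := (znorm (y - x))%:R.
(* In a coordinate [i] where [y] leaves the cube, [m] is [x_i + 1] if it leaves below 0 and
   [n - x_i] if it leaves above [n - 1]. *)
have [m [rm m0 mflux]] : exists m, [/\ (m <= znorm (y - x)%R)%N, (0 < m)%N
    & m%:R `^ (- s) <= box_flux s n x].
  have := YB y yY; rewrite mem_zbox => /forallPn[i yi].
  have := le_znorm (y - x) i; rewrite !mxE => ri.
  move: xB; rewrite mem_zbox => /forallP/(_ i) xi.
  have fluxi : (`|x ord0 i|%N.+1)%:R `^ (- s) + (n - `|x ord0 i|%N)%:R `^ (- s)
      <= box_flux s n x.
    rewrite /box_flux (bigD1 i) //=; apply: ler_wpDr => //.
    by apply: sumr_ge0 => j _; exact: addr_ge0.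
  have [y0|y0] := ltP (y ord0 i) 0.
    exists (`|x ord0 i|%N.+1); split=> //; last first.
      by apply: le_trans fluxi; rewrite lerDl.
    apply: leq_trans ri; move: xi y0; move: (x ord0 i) (y ord0 i) => a b; lia.
  exists (n - `|x ord0 i|%N)%N; split; last first.
  - by apply: le_trans fluxi; rewrite lerDr.
  - by move: xi; move: (x ord0 i) => a; lia.
  - apply: leq_trans ri; move: xi y0 yi; move: (x ord0 i) (y ord0 i) => a b; lia.
have mR : 0 < m%:R :> R by rewrite ltr0n.
have mr : m%:R <= r by rewrite ler_nat.
apply: (@le_trans _ _ (r `^ s * m%:R `^ (- s))); last first.
  by apply: ler_wpM2l => //; exact: powR_ge0.
rewrite powRN ler_pdivlMr ?powR_gt0 // mul1r.
apply: ge0_ler_powR; rewrite ?nnegrE ?ler0n //; exact: ltW.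
Qed.

Lemma sum_box_flux_le s s' n : s' < s -> s' <= 1 ->
  \sum_(x <- zbox 0 n) box_flux s n x
    <= (1 + (s - s')^-1) *+ 2 *+ d * (n%:R ^+ d.-1 * n%:R `^ (1 - s')).
Proof.
move=> ss' s1; rewrite /box_flux exchange_big /=.
have S := sum_powR_le n ss' s1.
apply: (@le_trans _ _ (\sum_(i < d) n%:R ^+ d.-1 *
    (\sum_(k < n) (k.+1%:R : R) `^ (- s)) *+ 2)).
  apply: ler_sum => i _.
  pose u (k : int) : R := (`|k|%N.+1)%:R `^ (- s) + (n - `|k|%N)%:R `^ (- s).
  rewrite (sum_zbox_coord 0 n u i) /u.
  rewrite big_split /= mulr2n mulrDr; apply: lerD.
    by rewrite le_eqVlt; apply/orP; left; apply/eqP; congr (_ * _); apply: eq_bigr.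
  (* Reflecting the coordinate turns distances to the upper face into distances to the lower one. *)
  rewrite [X in _ <= _ * X](reindex_inj rev_ord_inj) /=.
  rewrite le_eqVlt; apply/orP; left; apply/eqP; congr (_ * _).
  apply: eq_bigr => k _; congr (_ `^ _); congr (_%:R).
  by have := ltn_ord k; move: (nat_of_ord k) => m; lia.
rewrite sumr_const card_ord 2!mulrnAl ler_wMn2r // ler_wMn2r //.
rewrite [leRHS]mulrCA; apply: ler_wpM2l; first exact: exprn_ge0.
by rewrite mulrC.
Qed.

End kernel_sums.

(** * The critical exponent *)

Section expected_cluster.
Context {R : realType} {d : nat}.
Local Notation V := 'rV[int]_d.

Lemma exponent_tail (P : probability (configuration d) R) (delta t : R) :
  has_exponent_delta P delta -> 0 < t -> t < delta^-1 ->
  exists2 C : R, 1 <= C &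
    forall k, (0 < k)%N -> (P (cluster_ge d k) <= (C * k%:R `^ (- t))%:E)%E.
Proof.
move=> [eps [eps0 Peps]] t0 td.
have epsd : \forall n \near \oo, eps n < delta^-1 - t.
  by apply: (cvgr_lt 0 eps0); rewrite subr_gt0.
have [n0 _ hn0] := filterI Peps epsd.
have C1 : 1 <= n0.+1%:R `^ t :> R.
  have : 1 `^ t <= n0.+1%:R `^ t :> R.
    by apply: ge0_ler_powR; rewrite ?nnegrE ?(ltW t0) ?ler1n ?ler01 ?ler0n.
  by rewrite powR1.
(* This constant makes the bound at least 1 for [k < n0], where the asymptotics give no
   information. *)
exists (n0.+1%:R `^ t) => // k k0.
have kR : 0 < k%:R :> R by rewrite ltr0n.
have [kn|nk] := leqP n0 k.
  have [-> /ltW epsk] := hn0 k kn.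
  rewrite lee_fin -[leLHS]mul1r; apply: ler_pM => //.
  by apply: ler_powR; [rewrite ler1n|lra].
apply: le_trans (probability_le1 _ (measurable_cluster_ge _)) _.
rewrite lee_fin powRN ler_pdivlMr ?powR_gt0 // mul1r.
by apply: ge0_ler_powR; rewrite ?nnegrE ?(ltW t0) // ler_nat ltnW // ltnW.
Qed.

Variable p : edge d -> R.
Hypothesis p01 : forall e, 0 <= p e <= 1.
Variables (X : {fset V}) (C t t1 : R).
Hypothesis C_ge1 : 1 <= C.
Hypothesis tail : forall x k, (0 < k)%N -> pr p X (cl_ge X x k) <= C * k%:R `^ (- t1).
Hypotheses (tt1 : t < t1) (t_le1 : t <= 1).

Lemma pr_max_ge_half M : (0 < M)%N -> 2 * C * (#|` X|)%:R <= M%:R `^ (1 + t) ->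
  pr p X (max_ge X M) <= 2^-1.
Proof.
move=> M0 hM; have MR : 0 < M%:R :> R by rewrite ltr0n.
have C0 : 0 <= C by apply: le_trans C_ge1.
have : M%:R * pr p X (max_ge X M) <= (#|` X|)%:R * (C * M%:R `^ (- t)).
  apply: le_trans (pr_max_ge_markov p01 X M) _.
  apply: (@le_trans _ _ (\sum_(x <- X) C * M%:R `^ (- t))).
    apply: ler_sum => x _; apply: le_trans (tail x M0) _; apply: ler_wpM2l => //.
    by apply: ler_powR; rewrite ?ler1n // lerN2 ltW.
  by rewrite big_const_seq count_predT iter_addr_0 mulr_natl.
rewrite -ler_pdivlMl // => /le_trans; apply.
have MD : M%:R `^ (1 + t) = M%:R * M%:R `^ t :> R.
  by rewrite powRD ?powRr1 ?(ltW MR) //; apply/implyP => _; rewrite gt_eqF.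
have u0 : 0 < M%:R `^ t :> R by exact: powR_gt0.
rewrite MD in hM; rewrite powRN.
have -> : M%:R^-1 * ((#|` X|)%:R * (C * (M%:R `^ t)^-1))
    = C * (#|` X|)%:R / (M%:R * M%:R `^ t) :> R.
  by field; rewrite !gt_eqF.
by rewrite ler_pdivrMr ?mulr_gt0 // ler_pdivlMl // mulrA.
Qed.

(** Truncate at [3^j M]. Below, the tail bound is summed, using the gap between [t] and [t1]. Above,
    the probability is at most [2^(-2^j)], which beats the volume, so this part contributes at most
    1. *)
Lemma expected_cluster_le M j x : (0 < M)%N ->
  2 * C * (#|` X|)%:R <= M%:R `^ (1 + t) -> (#|` X| <= 2 ^ (2 ^ j))%N ->
  \sum_(y <- X) pr p X (conn_ev X x y)
    <= C * (1 + (t1 - t)^-1) * (3 ^ j * M)%:R `^ (1 - t) + 1.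
Proof.
move=> M0 hM Xj; apply: le_trans (expected_cl_le p01 X x (3 ^ j * M)) _.
have C0 : 0 <= C by apply: le_trans C_ge1.
apply: lerD.
  apply: (@le_trans _ _ (\sum_(k < 3 ^ j * M) C * k.+1%:R `^ (- t1))).
    by apply: ler_sum => k _; exact: tail.
  rewrite -mulr_sumr -mulrA; apply: ler_wpM2l => //.
  by rewrite mulrC; exact: sum_powR_le.
have half : pr p X (max_ge X (3 ^ j * M)) <= 2^-1 ^+ (2 ^ j).
  apply: le_trans (pr_max_ge_exp p01 X j M0) _.
  by apply: lerXn2r; rewrite ?nnegrE ?pr_ge0 // ?invr_ge0 //; exact: pr_max_ge_half.
apply: (@le_trans _ _ ((2 ^ (2 ^ j))%:R * 2^-1 ^+ (2 ^ j))).
  by apply: ler_pM => //; [exact: pr_ge0|rewrite ler_nat].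
by rewrite natrX -exprMn divff // expr1n.
Qed.

End expected_cluster.

(** At [t0 = (D - a) / (D + a)] the quantity [D (1 - t) / (1 + t)] equals [a], and it decreases in
    [t]. The assumption on [delta] says [t0 < 1 / delta], so [t] can be taken above [t0], leaving
    room for [s'] and [s] below [a]. *)
Lemma choose_exponents (R : realType) (D a delta : R) :
  0 < a -> a < D -> 0 < delta -> delta < (D + a) / (D - a) ->
  exists t t1 s s' : R, [/\ [/\ 0 < t, t < t1, t1 < delta^-1 & t1 < 1],
    [/\ 0 < s', s' < s & s < a] & D * (1 - t) < s' * (1 + t)].
Proof.
move=> a0 aD d0 dlt; have Da : 0 < D - a by rewrite subr_gt0.
have D0 : 0 < D := lt_trans a0 aD.
have Dpa : 0 < D + a by rewrite addr_gt0.
pose t0 := (D - a) / (D + a); have t00 : 0 < t0 by rewrite divr_gt0.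
have t0d : t0 < delta^-1.
  by rewrite /t0 -[ltLHS]invrK invf_div ltf_pV2 ?posrE ?divr_gt0.
have t01 : t0 < 1 by rewrite /t0 ltr_pdivrMr // mul1r; lra.
pose m := Num.min delta^-1 1; have t0m : t0 < m by rewrite lt_min t0d t01.
have md : m <= delta^-1 by rewrite ge_min lexx.
have m1 : m <= 1 by rewrite ge_min lexx orbT.
pose t1 := (t0 + m) / 2; pose t := (t0 + t1) / 2.
have h1 : t0 < t1 by rewrite /t1; lra.
have h2 : t1 < m by rewrite /t1; lra.
have h3 : t0 < t by rewrite /t; lra.
have h4 : t < t1 by rewrite /t; lra.
have t1p : 0 < 1 + t by lra.
pose b := D * (1 - t) / (1 + t).
have b0 : 0 <= b by rewrite /b divr_ge0 ?mulr_ge0; lra.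
have ba : b < a.
  rewrite /b ltr_pdivrMr //; move: h3; rewrite /t0 ltr_pdivrMr //; lra.
pose s' := (b + a) / 2; pose s := (s' + a) / 2.
exists t, t1, s, s'; split; first by split; lra.
  by split; rewrite /s /s'; lra.
by rewrite -ltr_pdivrMr // -/b /s'; lra.
Qed.

Lemma sqr_le_exp2 j : (4 <= j -> j * j <= 2 ^ j)%N.
Proof.
elim: j => // j ih; rewrite leq_eqVlt => /orP[/eqP <- //|j4].
by have := ih j4; rewrite expnS; nia.
Qed.

Section box_estimate.
Context {R : realType} {d : nat}.
Local Notation V := 'rV[int]_d.
Variables (p : edge d -> R) (bc H s s' C t t1 : R).
Hypothesis p01 : forall e, 0 <= p e <= 1.
Hypothesis d_gt0 : (0 < d)%N.
Hypotheses (bc_ge0 : 0 <= bc) (H_ge0 : 0 <= H) (s'_lt : s' < s) (s'_le1 : s' <= 1).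
Hypothesis critical : forall n v, v \in zbox 0 n ->
  1 <= bc * \sum_(x <- zbox 0 n)
    pr p (zbox 0 n) (conn_ev (zbox 0 n) v x) * (H * box_flux s n x).
Hypothesis C_ge1 : 1 <= C.
Hypothesis tail : forall X x k, (0 < k)%N -> pr p X (cl_ge X x k) <= C * k%:R `^ (- t1).
Hypotheses (t_ge0 : 0 <= t) (tt1 : t < t1) (t_le1 : t <= 1).

(** Summing [critical] over the [n^d] starting points and exchanging sums gives, by symmetry of
    connections, at most [E] times the total flux, which is of order [n ^ (d - s')]. *)
Lemma box_estimate n E : (0 < n)%N -> 0 <= E ->
  (forall x : V, \sum_(v <- zbox 0 n) pr p (zbox 0 n) (conn_ev (zbox 0 n) x v) <= E) ->
  n%:R `^ s' <= bc * H * ((1 + (s - s')^-1) *+ 2 *+ d) * E.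
Proof.
move=> n0 E0 hE; set B := zbox 0 n : {fset V}.
have nR : 0 < n%:R :> R by rewrite ltr0n.
have flux0 x : 0 <= box_flux s n x.
  by apply: sumr_ge0 => i _; apply: addr_ge0; exact: powR_ge0.
have sum1 : (n%:R : R) ^+ d <= bc * \sum_(x <- B) H * box_flux s n x * E.
  apply: (@le_trans _ _ (\sum_(v <- B)
      bc * \sum_(x <- B) pr p B (conn_ev B v x) * (H * box_flux s n x))).
    rewrite -natrX -(card_zbox 0 n) -[leLHS]mul1r.
    rewrite [leLHS](_ : _ = \sum_(v <- B) 1); last first.
      by rewrite big_const_seq count_predT iter_addr_0 mul1r.
    by rewrite big_seq [leRHS]big_seq; apply: ler_sum => v; exact: critical.
  rewrite -mulr_sumr; apply: ler_wpM2l => //.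
  rewrite exchange_big /=; apply: ler_sum => x _.
  rewrite -mulr_suml mulrC; apply: ler_wpM2l; first exact: mulr_ge0.
  apply: le_trans (hE x); apply: ler_sum => v _; apply: pr_le => // w.
  by apply: conn_sym; exact: open_adj_sym.
have nd : (n%:R : R) ^+ d = n%:R ^+ d.-1 * n%:R by rewrite -exprSr prednK.
have sum2 : \sum_(x <- B) H * box_flux s n x * E
    <= H * ((1 + (s - s')^-1) *+ 2 *+ d * (n%:R ^+ d.-1 * n%:R `^ (1 - s'))) * E.
  rewrite -mulr_suml -mulr_sumr; apply: ler_wpM2r => //; apply: ler_wpM2l => //.
  exact: sum_box_flux_le.
have := le_trans sum1 (ler_wpM2l bc_ge0 sum2).
set K := (1 + _) *+ 2 *+ d; rewrite nd.
rewrite powRB ?powRr1 ?(ltW nR) //; last by apply/implyP => _; rewrite gt_eqF.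
have u0 : 0 < n%:R `^ s' :> R by exact: powR_gt0.
have nd0 : 0 < (n%:R : R) ^+ d.-1 * n%:R by rewrite mulr_gt0 ?exprn_gt0.
have -> : bc * (H * (K * (n%:R ^+ d.-1 * (n%:R / n%:R `^ s'))) * E)
   = (n%:R ^+ d.-1 * n%:R) * ((bc * H * K * E) / n%:R `^ s') :> R by ring.
by rewrite ler_pMr // ler_pdivlMr // mul1r.
Qed.

(* Side [2 ^ (q * j)] makes the truncation loss [3 ^ j] negligible for large [q],
   while [j] tripling steps already beat the volume of the cube. *)
Lemma scale_estimate q j : (q * j * d <= 2 ^ j)%N ->
  ((2 ^ (q * j))%:R : R) `^ s' <= bc * H * ((1 + (s - s')^-1) *+ 2 *+ d) *
    ((C * (1 + (t1 - t)^-1) + 1) * (2 * (2 * C) `^ (1 + t)^-1) `^ (1 - t)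
     * ((2 ^ j)%:R ^+ 2 * (2 ^ (q * j))%:R `^ (d%:R / (1 + t))) `^ (1 - t)).
Proof.
move=> qj; set n := (2 ^ (q * j))%N; set B := zbox 0 n : {fset V}.
have n0 : (0 < n)%N by rewrite expn_gt0.
have nR : 0 < n%:R :> R by rewrite ltr0n.
have C0 : 0 < C := lt_le_trans ltr01 C_ge1.
have t1p : 0 < 1 + t by rewrite ltr_pwDl.
have z0 : 0 <= (t1 - t)^-1 by rewrite invr_ge0 subr_ge0 ltW.
have Cz : 0 <= C * (1 + (t1 - t)^-1) by rewrite mulr_ge0 ?(ltW C0) // addr_ge0.
have cardB : #|` B| = (n ^ d)%N by exact: card_zbox.
(* [y] solves [y ^ (1 + t) = 2 C n^d], the threshold for [pr_max_ge_half]; [M] below is an integer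
   between [y] and [2 y], as [y >= 1]. *)
pose y : R := (2 * C) `^ (1 + t)^-1 * n%:R `^ (d%:R / (1 + t)).
have yE : y = (2 * C * (n ^ d)%:R) `^ (1 + t)^-1.
  rewrite powRM ?mulr_ge0 ?(ltW C0) // natrX -powR_mulrn ?(ltW nR) //.
  by rewrite -powRrM.
have y1 : 1 <= y.
  have : 1 `^ (1 + t)^-1 <= y.
    rewrite yE; apply: ge0_ler_powR; rewrite ?nnegrE ?ler01 ?invr_ge0 ?(ltW t1p) //.
      by rewrite !mulr_ge0 ?(ltW C0).
    have : 1 <= (n ^ d)%:R :> R by rewrite ler1n expn_gt0 n0.
    move=> h; rewrite -[leLHS]mulr1; apply: ler_pM => //.
    by have := C_ge1; lra.
  by rewrite powR1.
pose M := (Num.truncn y).+1.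
have yM : y <= M%:R by rewrite ltW // truncnS_gt.
have My : M%:R <= 2 * y.
  have : (Num.truncn y)%:R <= y by rewrite truncn_le; lra.
  by rewrite /M -natr1; lra.
have hM : 2 * C * (#|` B|)%:R <= M%:R `^ (1 + t).
  have -> : 2 * C * (#|` B|)%:R = y `^ (1 + t).
    by rewrite cardB yE -powRrM mulVf ?gt_eqF // powRr1 // !mulr_ge0 ?(ltW C0).
  apply: ge0_ler_powR; rewrite ?nnegrE ?(ltW t1p) //.
  by apply: le_trans y1.
have Bj : (#|` B| <= 2 ^ (2 ^ j))%N by rewrite cardB /n -expnM leq_exp2l.
have E x := expected_cluster_le p01 C_ge1 (@tail B) tt1 t_le1 x (ltn0Sn _ : (0 < M)%N) hM Bj.
apply: (box_estimate n0); first by rewrite !mulr_ge0 ?powR_ge0 // addr_ge0.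
move=> x; apply: le_trans (E x) _.
have w1 : 1 <= (3 ^ j * M)%:R `^ (1 - t) :> R.
  have : 1 `^ (1 - t) <= (3 ^ j * M)%:R `^ (1 - t) :> R.
    by apply: ge0_ler_powR; rewrite ?nnegrE ?subr_ge0 ?ler01 ?ler0n // ler1n muln_gt0 expn_gt0.
  by rewrite powR1.
apply: (@le_trans _ _ ((C * (1 + (t1 - t)^-1) + 1) * (3 ^ j * M)%:R `^ (1 - t))).
  by rewrite mulrDl mul1r lerD2l.
rewrite -mulrA; apply: ler_wpM2l; first by rewrite addr_ge0.
rewrite -powRM ?mulr_ge0 ?powR_ge0 ?exprn_ge0 //.
apply: ge0_ler_powR; rewrite ?nnegrE ?subr_ge0 ?mulr_ge0 ?powR_ge0 ?exprn_ge0 //.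
rewrite natrM.
have -> : 2 * (2 * C) `^ (1 + t)^-1 * ((2 ^ j)%:R ^+ 2 * n%:R `^ (d%:R / (1 + t)))
   = (2 ^ j)%:R ^+ 2 * (2 * y) :> R by rewrite /y; ring.
apply: ler_pM => //.
(* The truncation loss satisfies [3^j <= 4^j = (2^j)^2]. *)
by rewrite -natrX ler_nat -expnM mulnC expnM; elim: (j) => // i ih; rewrite !expnS leq_mul.
Qed.

End box_estimate.

(** * Comparison of exponents at a large scale *)

Unset Implicit Arguments.

Theorem theorem1p1 (R : realType) (d : nat) (alpha : R)
    (N : 'rV[R]_d -> R) (J : 'rV[int]_d -> 'rV[int]_d -> R)
    (P : R -> probability (configuration d) R) (delta : R)
    (d_ge1 : (1 <= d)%N)
    (alpha_gt0 : 0 < alpha)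
    (alpha_lt1 : d = 1%N -> alpha < 1)
    (N_norm : is_norm N)
    (J_ge0 : forall x y, 0 <= J x y)
    (J_sym : symmetric_kernel J)
    (J_trans : translation_invariant J)
    (J_int : integrable_kernel J)
    (J_decay : exists C1 : R, forall x y : 'rV[int]_d, x != y ->
       J x y <= C1 * N (toR R x - toR R y) `^ (- d%:R - alpha))
    (P_perc : forall beta : R, 0 <= beta -> is_percolation_measure J beta (P beta))
    (beta_c_fin : (beta_c P < +oo)%E)
    (delta_gt0 : 0 < delta)
    (delta_exp : has_exponent_delta (P (fine (beta_c P))) delta) :
  (d%:R + Num.min alpha 1) / (d%:R - Num.min alpha 1) <= delta.
Proof.
have arith (u v w : R) : 3 <= u -> 0 < w -> 1 + (2 * (1 - w) + (v - u)) <= v by lra.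
rewrite leNgt; apply/negP => dlt.
set a := Num.min alpha 1 in dlt; set bc := fine (beta_c P) in delta_exp.
have a0 : 0 < a by rewrite lt_min alpha_gt0 ltr01.
have aalpha : a <= alpha by rewrite ge_min lexx.
have a1 : a <= 1 by rewrite ge_min lexx orbT.
(* Only for [d = 1] does this need [alpha < 1]; it makes the denominator positive. *)
have ad : a < d%:R.
  move: d_ge1; rewrite leq_eqVlt => /orP[/eqP d1|d2].
    by apply: le_lt_trans aalpha _; rewrite -d1 alpha_lt1.
  by apply: le_lt_trans a1 _; rewrite ltr1n.
have [t [t1 [s [s' [[t0 tt1 t1d t11] [s'0 s's sa] cond]]]]] :=
  choose_exponents a0 ad delta_gt0 dlt.
have bc0 : 0 <= bc by rewrite /bc fine_ge0 // beta_c_ge0.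
have Popen := P_open J_sym P_perc bc0.
have Pindep := P_indep P_perc bc0.
have [C C1 hC] := exponent_tail delta_exp (lt_trans t0 tt1) t1d.
have [H H0 hH] := kernel_moment d_ge1 N_norm alpha_gt0 J_decay (lt_le_trans sa aalpha).
pose p := edge_prob J bc.
have tail X x k : (0 < k)%N -> pr p X (cl_ge X x k) <= C * k%:R `^ (- t1).
  move=> k0; rewrite -lee_fin; apply: le_trans (hC k k0).
  exact: (pr_cl_ge_le Popen Pindep (edge_prob_tr J_sym J_trans bc)).
have s0 : 0 < s := lt_trans s'0 s's.
have critical n v : v \in zbox 0 n ->
  1 <= bc * \sum_(x <- zbox 0 n)
    pr p (zbox 0 n) (conn_ev (zbox 0 n) v x) * (H * box_flux s n x).
  move=> vB; apply: (@critical_phi_ge1 _ _ _ J_sym J_trans _ P_perc beta_c_fin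
    _ _ (fun x => H * box_flux s n x) vB).
  by move=> x Y xB YB; exact: box_flux_bound.
have s'1 : s' <= 1 by lra.
have scale := scale_estimate (p01 Popen) d_ge1 bc0 H0 s's s'1 critical C1 tail
  (ltW t0) tt1 (ltW (lt_trans tt1 t11)).
have t1p : 0 < 1 + t by lra.
(* The gain per unit of the exponent of [n], positive by the choice of [t] and [s']. Taking
   [q kappa >= 3] then covers the loss [2 (1 - t)] from truncation and one further power of [2^j]
   for the constants. *)
pose kappa := s' - d%:R * (1 - t) / (1 + t).
have kappa0 : 0 < kappa by rewrite subr_gt0 ltr_pdivrMr.
pose q := (Num.truncn (3 / kappa)).+1.
have qk : 3 <= q%:R * kappa by rewrite -ler_pdivrMr // ltW // truncnS_gt.
set A1 := bc * H * ((1 + (s - s')^-1) *+ 2 *+ d) in scale.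
set A2 := (C * (1 + (t1 - t)^-1) + 1) * (2 * (2 * C) `^ (1 + t)^-1) `^ (1 - t) in scale.
(* The three lower bounds on [j] give [j^2 <= 2^j], then [q j d <= j^2 <= 2^j], and finally
   [A1 * A2 < 2^j]. *)
pose j := maxn 4 (maxn (q * d) (Num.truncn (A1 * A2)).+1).
have j4 : (4 <= j)%N by rewrite leq_maxl.
have jqd : (q * d <= j)%N by rewrite /j !leq_max leqnn orbT.
have jA : ((Num.truncn (A1 * A2)).+1 <= j)%N by rewrite /j !leq_max leqnn !orbT.
have jj := sqr_le_exp2 j4.
have qjd : (q * j * d <= 2 ^ j)%N.
  by rewrite mulnAC; apply: leq_trans jj; rewrite leq_mul2r jqd orbT.
have := scale q j qjd.
set x : R := (2 ^ j)%:R; have x1 : 1 <= x by rewrite ler1n expn_gt0.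
have x0 : 0 < x := lt_le_trans ltr01 x1.
have -> : (2 ^ (q * j))%:R = x `^ q%:R :> R.
  by rewrite powR_mulrn ?(ltW x0) // /x -natrX -expnM mulnC.
rewrite -powR_mulrn ?(ltW x0) // -!powRrM -powRD; last first.
  by apply/implyP => _; rewrite gt_eqF.
rewrite -powRrM mulrA; set e := (_ + _) * _; apply/negP; rewrite -ltNge.
have xA : A1 * A2 < x.
  apply: lt_le_trans (truncnS_gt _) _; rewrite ler_nat.
  by apply: leq_trans jA _; apply: ltnW; exact: ltn_expl.
have xe0 : 0 < x `^ e by exact: powR_gt0.
apply: (@lt_le_trans _ _ (x * x `^ e)); first by rewrite ltr_pM2r.
have -> : x * x `^ e = x `^ (1 + e).
  by rewrite powRD ?powRr1 ?(ltW x0) //; apply/implyP => _; rewrite gt_eqF.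
apply: ler_powR => //.
(* With [x = 2^j] the estimate reads [x ^ (q s') <= A1 A2 x^e], and its right side is below
   [x ^ (1 + e)]. It is refuted by [1 + e <= q s'], which is [arith] for [u = q kappa], [v = q s']
   and [w = t]. *)
have -> : e = 2 * (1 - t) + q%:R * (s' - kappa).
  by rewrite /e /kappa; field; rewrite gt_eqF.
by rewrite (mulrBr q%:R); exact: arith.
Qed.
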